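(* Let $f,g:[0;1]\to[0;1]^2$ be computable with $f(0)=(0,0)$, $f(1)=(1,1)$, $g(0)=(0,1)$, $g(1)=(1,0)$ and $f(t),g(t)\in(0;1)^2$ for $0<t<1$. If the predicate $Q$ holds, then $f(\alpha)\in\mathrm{range}(g)$ for some computable number $\alpha\in\mathbb{R}$.
   Context: $B(z,r)$ denotes the open Euclidean ball in $\mathbb{R}^2$, $\overline{B(z,r)}$ its closure. For rationals $a,r$ with $\overline{B(f(a),r)}\subseteq(0;1)^2$: $(p_{ar};q_{ar})$ is the longest open interval $I$ with $a\in I$ and $f(I)\subseteq B(f(a),r)$; $(p'_{ar};q'_{ar})$ is the longest open interval $I$ with $a\in I$ and $f(\overline I)\subseteq\overline{B(f(a),r)}$; $K_{ar}:=[p'_{ar};p_{ar}]$, $L_{ar}:=[q_{ar};q'_{ar}]$. The predicate $Q$ states: there are rationals $a,r,s$ with $0<r<s$ and $\overline{B(f(a),s)}\subseteq(0;1)^2$ such that for every rational $t\in[r;s]$, $f(\max K_{at})\in\mathrm{range}(g)$ or $f(\min L_{at})\in\mathrm{range}(g)$. *)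

(* Defs.v *)
From Stdlib Require Import Reals QArith Qreals Cantor ClassicalEpsilon.

Open Scope R_scope.

(** ** Oracle computability

    Kleene's partial recursive functionals.  Functions are unary; tuples are
    coded by the Cantor bijection of the standard library.  A Type-2 machine
    reading an infinite input [phi] is a program with oracle access to [phi]. *)

Inductive code : Set :=
| Zero
| Succ
| Fst
| Snd
| Query
| Pair (c d : code)
| Comp (c d : code)
| PrimRec (c d : code)
| Mu (c : code).

(** [eval phi c x y]: on input [x] with oracle [phi], program [c] halts with
    output [y].  [PrimRec c d] computes [h (a, 0) = c a] and
    [h (a, k + 1) = d (a, (k, h (a, k)))]; [Mu c] maps [x] to the least [y] with
    [c (x, y) = 0], all the earlier values being defined. *)
Fixpoint eval (phi : nat -> nat) (c : code) (x y : nat) {struct c} : Prop :=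
  match c with
  | Zero => y = 0%nat
  | Succ => y = S x
  | Fst => y = fst (of_nat x)
  | Snd => y = snd (of_nat x)
  | Query => y = phi x
  | Pair c d => exists u v, eval phi c x u /\ eval phi d x v /\ y = to_nat (u, v)
  | Comp c d => exists u, eval phi d x u /\ eval phi c u y
  | PrimRec c d =>
      let a := fst (of_nat x) in
      let n := snd (of_nat x) in
      exists h : nat -> nat,
        eval phi c a (h 0%nat) /\
        (forall k, (k < n)%nat -> eval phi d (to_nat (a, to_nat (k, h k))) (h (S k))) /\
        y = h n
  | Mu c =>
      eval phi c (to_nat (x, y)) 0%nat /\
      (forall k, (k < y)%nat -> exists v, eval phi c (to_nat (x, k)) (S v))
  end.

Definition computes (phi : nat -> nat) (c : code) (psi : nat -> nat) : Prop :=
  forall n, eval phi c n (psi n).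

(** ** Cauchy representation of the reals and of the plane *)

(** The standard numbering of the rationals: [((i, j), k)] codes
    [(i - j) / (k + 1)]. *)
Definition nuQ (n : nat) : Q :=
  let (ij, k) := of_nat n in
  let (i, j) := of_nat ij in
  Qmake (Z.of_nat i - Z.of_nat j) (Pos.of_succ_nat k).

Definition cauchy_name (phi : nat -> nat) (x : R) : Prop :=
  forall n, Rabs (Q2R (nuQ (phi n)) - x) <= (/ 2) ^ n.

(** A name of a point of the plane is a pair of names of its coordinates. *)
Definition cauchy_name2 (phi : nat -> nat) (z : R * R) : Prop :=
  cauchy_name (fun n => fst (of_nat (phi n))) (fst z) /\
  cauchy_name (fun n => snd (of_nat (phi n))) (snd z).

Definition computable_number (x : R) : Prop :=
  exists (c : code) (psi : nat -> nat),
    computes (fun _ => 0%nat) c psi /\ cauchy_name psi x.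

(** Partial functions with domain [0;1] are total functions whose values outside
    [0;1] are irrelevant. *)
Definition computable_path (f : R -> R * R) : Prop :=
  exists c : code, forall (x : R) (phi : nat -> nat),
    0 <= x <= 1 -> cauchy_name phi x ->
    exists psi, computes phi c psi /\ cauchy_name2 psi (f x).

(** ** Geometry *)

Definition open_square (z : R * R) : Prop := 0 < fst z < 1 /\ 0 < snd z < 1.

Definition closed_square (z : R * R) : Prop := 0 <= fst z <= 1 /\ 0 <= snd z <= 1.

Definition dist2 (z w : R * R) : R := dist_euc (fst z) (snd z) (fst w) (snd w).

Definition open_ball (z : R * R) (r : R) (w : R * R) : Prop := dist2 z w < r.

Definition closed_ball (z : R * R) (r : R) (w : R * R) : Prop := dist2 z w <= r.

Definition in_range (g : R -> R * R) (z : R * R) : Prop :=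
  exists u, 0 <= u <= 1 /\ g u = z.

(** ** Exit times of a path from a ball *)

(** A pair [(u, v)] stands for the open interval with endpoints [u] and [v].  The
    bounds [0 <= u] and [v <= 1] express that the interval lies in the domain of
    the path. *)
Definition inner_interval (f : R -> R * R) (a r : R) (I : R * R) : Prop :=
  0 <= fst I /\ snd I <= 1 /\ fst I < a < snd I /\
  forall x, fst I < x < snd I -> open_ball (f a) r (f x).

Definition outer_interval (f : R -> R * R) (a r : R) (I : R * R) : Prop :=
  0 <= fst I /\ snd I <= 1 /\ fst I < a < snd I /\
  forall x, fst I <= x <= snd I -> closed_ball (f a) r (f x).

Definition is_longest (P : R * R -> Prop) (I : R * R) : Prop :=
  P I /\ forall J, P J -> snd J - fst J <= snd I - fst I.

(** For the two predicates above, a longest interval exists and is unique when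
    [f] is continuous on [0;1], [r > 0], and the closed ball of radius [r] around
    [f a] contains neither [f 0] nor [f 1]; otherwise the value may be
    arbitrary. *)
Definition longest (P : R * R -> Prop) : R * R :=
  epsilon (inhabits (0, 0)) (is_longest P).

Definition p (f : R -> R * R) (a r : R) : R := fst (longest (inner_interval f a r)).
Definition q (f : R -> R * R) (a r : R) : R := snd (longest (inner_interval f a r)).
Definition p' (f : R -> R * R) (a r : R) : R := fst (longest (outer_interval f a r)).
Definition q' (f : R -> R * R) (a r : R) : R := snd (longest (outer_interval f a r)).

Definition K (f : R -> R * R) (a r x : R) : Prop := p' f a r <= x <= p f a r.
Definition L (f : R -> R * R) (a r x : R) : Prop := q f a r <= x <= q' f a r.

Definition is_max (A : R -> Prop) (m : R) : Prop := A m /\ forall x, A x -> x <= m.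
Definition is_min (A : R -> Prop) (m : R) : Prop := A m /\ forall x, A x -> m <= x.

Definition predicate_Q (f g : R -> R * R) : Prop :=
  exists a r s : Q,
    0 <= Q2R a <= 1 /\
    0 < Q2R r < Q2R s /\
    (forall z, closed_ball (f (Q2R a)) (Q2R s) z -> open_square z) /\
    forall t : Q, Q2R r <= Q2R t <= Q2R s ->
      exists k l,
        is_max (K f (Q2R a) (Q2R t)) k /\
        is_min (L f (Q2R a) (Q2R t)) l /\
        (in_range g (f k) \/ in_range g (f l)).

(* Main.v *)
(** Let [H x] be the squared distance from [f a] to [f x].  For a radius [t] in
    [[r;s]] let [x_t < a < y_t] be the last point before [a] and the first point after
    [a] where [H] reaches [t^2]; these are [max K_{at}] and [min L_{at}].  They are
    monotone in [t], so every interval of radii contains a subinterval on which both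
    vary arbitrarily little.  That this happens is semidecidable: it is witnessed by
    finitely many values of [H] on a grid, once a modulus of continuity of [f] is
    computed.  Hence a search produces nested rational intervals of radii shrinking to
    a radius [t*] at which [x_t] and [y_t] are continuous, with computable values
    [alpha] and [beta].  Since [range(g)] is closed and rational radii accumulate at
    [t*], one of [f alpha], [f beta] lies in it.

    The modulus comes from compactness: a program reads only finitely much of the name
    of [x], so its output remains valid for all points with a name sharing that part,
    and finitely many such neighbourhoods of dyadic points cover [[0;1]]. *)

Require Import Defs.
From Stdlib Require Import Reals QArith Qreals Cantor ClassicalEpsilon Classical.
From Stdlib Require Import ZArith Wf_nat Lia Lra.
From Coquelicot Require Import Rcomplements Compactness.

Open Scope R_scope.

(** * Evaluation of programs *)

Local Notation zero_oracle := (fun _ : nat => 0%nat).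

Lemma eval_Fst phi a b : eval phi Fst (to_nat (a, b)) a.
Proof. cbn [eval]; now rewrite cancel_of_to. Qed.

Lemma eval_Snd phi a b : eval phi Snd (to_nat (a, b)) b.
Proof. cbn [eval]; now rewrite cancel_of_to. Qed.

Lemma eval_Pair phi c d x u v :
  eval phi c x u -> eval phi d x v -> eval phi (Pair c d) x (to_nat (u, v)).
Proof. intros; exists u, v; auto. Qed.

Lemma eval_Comp phi c d x u y :
  eval phi d x u -> eval phi c u y -> eval phi (Comp c d) x y.
Proof. intros; exists u; auto. Qed.

Lemma eval_PrimRec phi c d a n (h : nat -> nat) :
  eval phi c a (h 0%nat) ->
  (forall k, (k < n)%nat -> eval phi d (to_nat (a, to_nat (k, h k))) (h (S k))) ->
  eval phi (PrimRec c d) (to_nat (a, n)) (h n).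
Proof.
  intros Hc Hd; cbn [eval]; rewrite cancel_of_to; cbn [fst snd].
  exists h; auto.
Qed.

Lemma eval_Mu phi c x y (v : nat -> nat) :
  (forall k, (k < S y)%nat -> eval phi c (to_nat (x, k)) (v k)) ->
  v y = 0%nat -> (forall k, (k < y)%nat -> v k <> 0%nat) -> eval phi (Mu c) x y.
Proof.
  intros Hv H0 Hne; split.
  - specialize (Hv y (Nat.lt_succ_diag_r y)); now rewrite H0 in Hv.
  - intros k Hk; specialize (Hv k (Nat.lt_lt_succ_r _ _ Hk)); specialize (Hne k Hk).
    destruct (v k) as [|u]; [easy|now exists u].
Qed.

(** Since programs are given by a relation, this is what identifies an output obtained by [choice]
    with the output of a known run. For [Mu], the smaller of two results would have both a zero and
    a positive value. *)
Lemma eval_functional phi c : forall x y y', eval phi c x y -> eval phi c x y' -> y = y'.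
Proof.
  induction c as [| | | | |c IHc d IHd|c IHc d IHd|c IHc d IHd|c IHc];
    intros x y y'; try (simpl; congruence).
  - intros (u & v & Hu & Hv & ->) (u' & v' & Hu' & Hv' & ->).
    now rewrite (IHc _ _ _ Hu Hu'), (IHd _ _ _ Hv Hv').
  - intros (u & Hu & Hy) (u' & Hu' & Hy').
    rewrite (IHd _ _ _ Hu' Hu) in Hy'; eauto.
  - intros (h & H0 & Hs & ->) (h' & H0' & Hs' & ->).
    enough (forall k, (k <= snd (of_nat x))%nat -> h k = h' k) by auto.
    induction k as [|k IHk]; intros Hk; [eauto|].
    specialize (Hs k Hk); specialize (Hs' k Hk).
    rewrite IHk in Hs by lia; eauto.
  - intros (H0 & Hs) (H0' & Hs').
    destruct (Nat.lt_trichotomy y y') as [Hlt|[E|Hlt]]; [|exact E|].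
    + destruct (Hs' _ Hlt) as [v Hv]; discriminate (IHc _ _ _ H0 Hv).
    + destruct (Hs _ Hlt) as [v Hv]; discriminate (IHc _ _ _ H0' Hv).
Qed.

(** * Recursive functions *)

(** The constant zero oracle models computation without an oracle, as in [computable_number]. *)
Definition recf (F : nat -> nat) : Prop := exists c, computes zero_oracle c F.

Notation pr1 z := (fst (of_nat z)).
Notation pr2 z := (snd (of_nat z)).

Lemma recf_ext F G : (forall z, F z = G z) -> recf F -> recf G.
Proof. intros E [c Hc]; exists c; intro z; rewrite <- E; apply Hc. Qed.

Lemma recf_id : recf (fun z => z).
Proof.
  exists (Pair Fst Snd); intro z; exists (pr1 z), (pr2 z); repeat split.
  now rewrite <- surjective_pairing, cancel_to_of.
Qed.

Lemma recf_comp F A : recf F -> recf A -> recf (fun z => F (A z)).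
Proof. intros [c Hc] [d Hd]; exists (Comp c d); intro z; exists (A z); auto. Qed.

Lemma recf_S A : recf A -> recf (fun z => S (A z)).
Proof. apply (recf_comp S); exists Succ; now intro. Qed.

Lemma recf_const n : recf (fun _ => n).
Proof. induction n; [exists Zero; now intro|now apply recf_S]. Qed.

Lemma recf_pr1 A : recf A -> recf (fun z => pr1 (A z)).
Proof. apply (recf_comp (fun z => pr1 z)); exists Fst; now intro. Qed.

Lemma recf_pr2 A : recf A -> recf (fun z => pr2 (A z)).
Proof. apply (recf_comp (fun z => pr2 z)); exists Snd; now intro. Qed.

Lemma recf_pair A B : recf A -> recf B -> recf (fun z => to_nat (A z, B z)).
Proof. intros [c Hc] [d Hd]; exists (Pair c d); intro z; now apply eval_Pair. Qed.

Fixpoint prim (b s : nat -> nat) (a n : nat) : nat :=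
  match n with
  | O => b a
  | S k => s (to_nat (a, to_nat (k, prim b s a k)))
  end.

Lemma recf_prim b s A N :
  recf b -> recf s -> recf A -> recf N -> recf (fun z => prim b s (A z) (N z)).
Proof.
  intros [c Hc] [d Hd] HA HN.
  apply (recf_ext (fun z => (fun w => prim b s (pr1 w) (pr2 w)) (to_nat (A z, N z)))).
  { intro z; now rewrite cancel_of_to. }
  apply (recf_comp (fun w => prim b s (pr1 w) (pr2 w)) (fun z => to_nat (A z, N z)));
    [|now apply recf_pair].
  exists (PrimRec c d); intro w; exists (prim b s (pr1 w)).
  repeat split; [apply Hc|intros k _; apply Hd].
Qed.

Create HintDb recf.
#[local] Hint Resolve recf_id recf_S recf_const recf_pr1 recf_pr2 recf_pair : recf.

Ltac prim_step :=
  cbn [prim]; rewrite ?cancel_of_to; cbn [fst snd]; rewrite ?cancel_of_to; cbn [fst snd].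

Lemma recf_add A B : recf A -> recf B -> recf (fun z => (A z + B z)%nat).
Proof.
  intros HA HB.
  apply recf_ext with (fun z => prim (fun a => a) (fun w => S (pr2 (pr2 w))) (A z) (B z)).
  - intro z; induction (B z) as [|n IH]; prim_step; lia.
  - apply recf_prim; auto with recf.
Qed.
#[local] Hint Resolve recf_add : recf.

Lemma recf_mul A B : recf A -> recf B -> recf (fun z => (A z * B z)%nat).
Proof.
  intros HA HB.
  apply recf_ext with
    (fun z => prim (fun _ => 0%nat) (fun w => (pr1 w + pr2 (pr2 w))%nat) (A z) (B z)).
  - intro z; induction (B z) as [|n IH]; prim_step; lia.
  - apply recf_prim; auto with recf.
Qed.

Lemma recf_pow2 A : recf A -> recf (fun z => (2 ^ A z)%nat).
Proof.
  intros HA.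
  apply recf_ext with
    (fun z => prim (fun _ => 1%nat) (fun w => (pr2 (pr2 w) + pr2 (pr2 w))%nat) 0%nat (A z)).
  - intro z; induction (A z) as [|n IH]; [reflexivity|].
    prim_step; rewrite Nat.pow_succ_r'; lia.
  - apply recf_prim; auto with recf.
Qed.

Lemma recf_pred A : recf A -> recf (fun z => Nat.pred (A z)).
Proof.
  intros HA.
  apply recf_ext with (fun z => prim (fun _ => 0%nat) (fun w => pr1 (pr2 w)) 0%nat (A z)).
  - intro z; destruct (A z) as [|n]; prim_step; reflexivity.
  - apply recf_prim; auto with recf.
Qed.
#[local] Hint Resolve recf_mul recf_pow2 recf_pred : recf.

Lemma recf_sub A B : recf A -> recf B -> recf (fun z => (A z - B z)%nat).
Proof.
  intros HA HB.
  apply recf_ext with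
    (fun z => prim (fun a => a) (fun w => Nat.pred (pr2 (pr2 w))) (A z) (B z)).
  - intro z; induction (B z) as [|n IH]; prim_step; lia.
  - apply recf_prim; auto with recf.
Qed.
#[local] Hint Resolve recf_sub : recf.

Lemma recf_min A B : recf A -> recf B -> recf (fun z => Nat.min (A z) (B z)).
Proof.
  intros HA HB; apply recf_ext with (fun z => (A z - (A z - B z))%nat); [intro; lia|].
  auto with recf.
Qed.
#[local] Hint Resolve recf_min : recf.

(** * Decidable predicates and unbounded search *)

Definition decP (P : nat -> Prop) : Prop :=
  exists d, recf d /\ forall z, d z = 0%nat <-> P z.

Lemma decP_ext P P' : (forall z, P z <-> P' z) -> decP P -> decP P'.
Proof. intros E (d & Hd & H); exists d; split; auto; intro z; now rewrite H. Qed.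

Lemma decP_comp P A : decP P -> recf A -> decP (fun z => P (A z)).
Proof.
  intros (d & Hd & H) HA; exists (fun z => d (A z)); split; auto using recf_comp.
Qed.

Lemma decP_le A B : recf A -> recf B -> decP (fun z => (A z <= B z)%nat).
Proof.
  intros HA HB; exists (fun z => (A z - B z)%nat); split; [auto with recf|intro; lia].
Qed.

Lemma decP_and P P' : decP P -> decP P' -> decP (fun z => P z /\ P' z).
Proof.
  intros (d & Hd & H) (d' & Hd' & H'); exists (fun z => (d z + d' z)%nat); split.
  - auto with recf.
  - intro z; rewrite <- H, <- H'; lia.
Qed.

Lemma decP_not P : decP P -> decP (fun z => ~ P z).
Proof.
  intros (d & Hd & H); exists (fun z => (1 - d z)%nat); split.
  - auto with recf.
  - intro z; rewrite <- H; lia.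
Qed.

Lemma decP_imp P P' : decP P -> decP P' -> decP (fun z => P z -> P' z).
Proof.
  intros H H'; apply decP_ext with (fun z => ~ (P z /\ ~ P' z)).
  - intro z; split; [intros Hn Hp; apply NNPP; tauto|tauto].
  - auto using decP_not, decP_and.
Qed.

Lemma decP_forall (P : nat -> nat -> Prop) N :
  decP (fun w => P (pr1 w) (pr2 w)) -> recf N ->
  decP (fun z => forall j, (j <= N z)%nat -> P z j).
Proof.
  intros (d & Hd & H) HN.
  (* The recursion sums the values of [d]; a sum of naturals vanishes exactly when every term
     does. *)
  set (s := fun w => (pr2 (pr2 w) + d (to_nat (pr1 w, pr1 (pr2 w))))%nat).
  exists (fun z => prim (fun _ => 0%nat) s z (S (N z))); split.
  - apply recf_prim; auto with recf; unfold s.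
    apply recf_add; auto with recf; apply recf_comp; auto with recf.
  - intro z; set (n := S (N z)).
    assert (E : prim (fun _ => 0%nat) s z n = 0%nat <->
                forall j, (j < n)%nat -> P z j).
    { induction n as [|n IH]; [split; [intros; lia|auto]|].
      cbn [prim]; unfold s at 1; prim_step.
      rewrite Nat.eq_add_0, IH, H, cancel_of_to; cbn [fst snd].
      split; [intros [A B] j Hj|intros A; split; auto].
      destruct (Nat.eq_dec j n) as [->|]; [auto|apply A; lia]. }
    rewrite E; unfold n; split; intros A j Hj; apply A; lia.
Qed.

Lemma decP_exists (P : nat -> nat -> Prop) N :
  decP (fun w => P (pr1 w) (pr2 w)) -> recf N ->
  decP (fun z => exists j, (j <= N z)%nat /\ P z j).
Proof.
  intros HP HN.
  apply decP_ext with (fun z => ~ forall j, (j <= N z)%nat -> ~ P z j).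
  - intro z; split; [|now intros (j & Hj & H) A; apply (A j)].
    intro A; apply NNPP; intro B; apply A; intros j Hj Hp; apply B; eauto.
  - apply decP_not, decP_forall; auto; now apply decP_not.
Qed.

(** [Mu] looks for a zero, which is why truth is encoded by 0 in [decP]. Existence of a witness may
    be proved classically: the least witness is still found by the search. *)
Lemma recf_search (P : nat -> nat -> Prop) :
  decP (fun w => P (pr1 w) (pr2 w)) -> (forall x, exists y, P x y) ->
  exists M, recf M /\ forall x, P x (M x).
Proof.
  intros (d & [c Hc] & H) Hex.
  assert (Hmin : forall x, exists y, P x y /\ forall k, (k < y)%nat -> ~ P x k).
  { intro x; destruct (Hex x) as [y Hy].
    induction y as [y IH] using Wf_nat.lt_wf_ind.
    destruct (classic (exists k, (k < y)%nat /\ P x k)) as [(k & Hk & Hp)|Hn].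
    - now apply (IH k).
    - exists y; split; auto; intros k Hk Hp; apply Hn; eauto. }
  apply choice in Hmin; destruct Hmin as [M HM]; exists M.
  split; [|intro x; apply HM].
  exists (Mu c); intro x; destruct (HM x) as [H1 H2].
  apply eval_Mu with (fun k => d (to_nat (x, k))); [intros; apply Hc|..].
  - apply H; now rewrite cancel_of_to.
  - intros k Hk E; apply (H2 k Hk); apply H in E; now rewrite cancel_of_to in E.
Qed.

Lemma recf_div A B :
  recf A -> recf B -> (forall z, (0 < B z)%nat) -> recf (fun z => (A z / B z)%nat).
Proof.
  intros HA HB Hpos.
  destruct (recf_search (fun z k => (B z * k <= A z /\ S (A z) <= B z * S k)%nat))
    as (M & HM & H).
  - apply decP_and; apply decP_le; auto using recf_comp with recf.
  - intro z; exists (A z / B z)%nat; specialize (Hpos z).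
    pose proof (Nat.div_mod_eq (A z) (B z)).
    pose proof (Nat.mod_upper_bound (A z) (B z)); nia.
  - apply recf_ext with M; auto; intro z; specialize (H z); specialize (Hpos z).
    apply (Nat.div_unique _ _ _ (A z - B z * M z)); nia.
Qed.

(** * Rational-valued recursive functions *)

Definition val (n : nat) : R := Q2R (nuQ n).

Lemma val_spec n :
  val n = (INR (pr1 (pr1 n)) - INR (pr2 (pr1 n))) / INR (S (pr2 n)).
Proof.
  unfold val, nuQ; destruct (of_nat n) as [ij k]; cbn [fst snd].
  destruct (of_nat ij) as [i j]; cbn [fst snd].
  unfold Q2R; cbn [Qnum Qden].
  rewrite minus_IZR, <- !INR_IZR_INZ; unfold Rdiv; do 2 f_equal.
  rewrite INR_IZR_INZ; f_equal; lia.
Qed.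

Lemma val_code i j k :
  val (to_nat (to_nat (i, j), k)) = (INR i - INR j) / INR (S k).
Proof. rewrite val_spec, cancel_of_to; cbn [fst snd]; now rewrite cancel_of_to. Qed.

Lemma val_surjective (a : Q) : exists n, val n = Q2R a.
Proof.
  destruct a as [z d].
  exists (to_nat (to_nat (Z.to_nat z, Z.to_nat (- z)), Nat.pred (Pos.to_nat d))).
  rewrite val_code; unfold Q2R; cbn [Qnum Qden]; unfold Rdiv; f_equal.
  - rewrite !INR_IZR_INZ, <- minus_IZR; f_equal; lia.
  - f_equal; rewrite INR_IZR_INZ; f_equal; lia.
Qed.

(** The values are exact rationals, not approximated reals, so that comparisons between them are
    decidable. *)
Definition recR (A : nat -> R) : Prop := exists c, recf c /\ forall z, val (c z) = A z.

Lemma recR_comp A F : recR A -> recf F -> recR (fun z => A (F z)).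
Proof. intros (c & Hc & H) HF; exists (fun z => c (F z)); auto using recf_comp. Qed.

Lemma recR_val A : recf A -> recR (fun z => val (A z)).
Proof. intro H; exists A; auto. Qed.

Lemma recR_const (a : Q) : recR (fun _ => Q2R a).
Proof. destruct (val_surjective a) as [n Hn]; exists (fun _ => n); auto with recf. Qed.

Lemma recR_INR A : recf A -> recR (fun z => INR (A z)).
Proof.
  intro H; exists (fun z => to_nat (to_nat (A z, 0%nat), 0%nat)).
  split; [auto with recf|intro z; rewrite val_code; simpl; field].
Qed.

Lemma INR_pow2 n : INR (2 ^ n) = 2 ^ n.
Proof. now rewrite pow_INR. Qed.

(** [nuQ] stores a denominator minus one, so codes of fractions contain predecessors that have to be
    undone. *)
Lemma S_pred_pow2 n : S (Nat.pred (2 ^ n)) = (2 ^ n)%nat.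
Proof. pose proof (Nat.pow_nonzero 2 n); lia. Qed.

Lemma recR_half_pow A : recf A -> recR (fun z => (/ 2) ^ A z).
Proof.
  intro H; exists (fun z => to_nat (to_nat (1%nat, 0%nat), Nat.pred (2 ^ A z))).
  split; [auto with recf|intro z].
  rewrite val_code, S_pred_pow2, INR_pow2, pow_inv; simpl; field.
  apply pow_nonzero; lra.
Qed.

Lemma recR_opp A : recR A -> recR (fun z => - A z).
Proof.
  intros (c & Hc & H).
  exists (fun z => to_nat (to_nat (pr2 (pr1 (c z)), pr1 (pr1 (c z))), pr2 (c z))).
  split; [auto 10 with recf|intro z].
  rewrite val_code, <- H, val_spec; field; apply not_0_INR; lia.
Qed.

Lemma recR_add A B : recR A -> recR B -> recR (fun z => A z + B z).
Proof.
  intros (c & Hc & H) (d & Hd & H').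
  exists (fun z => to_nat (to_nat
    ((pr1 (pr1 (c z)) * S (pr2 (d z)) + pr1 (pr1 (d z)) * S (pr2 (c z)))%nat,
     (pr2 (pr1 (c z)) * S (pr2 (d z)) + pr2 (pr1 (d z)) * S (pr2 (c z)))%nat),
     Nat.pred (S (pr2 (c z)) * S (pr2 (d z))))).
  split; [auto 12 with recf|intro z].
  rewrite val_code, <- H, <- H', !val_spec.
  replace (S (Nat.pred _)) with (S (pr2 (c z)) * S (pr2 (d z)))%nat by lia.
  rewrite !plus_INR, !mult_INR; field; split; apply not_0_INR; lia.
Qed.

Lemma recR_mul A B : recR A -> recR B -> recR (fun z => A z * B z).
Proof.
  intros (c & Hc & H) (d & Hd & H').
  exists (fun z => to_nat (to_nat
    ((pr1 (pr1 (c z)) * pr1 (pr1 (d z)) + pr2 (pr1 (c z)) * pr2 (pr1 (d z)))%nat,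
     (pr1 (pr1 (c z)) * pr2 (pr1 (d z)) + pr2 (pr1 (c z)) * pr1 (pr1 (d z)))%nat),
     Nat.pred (S (pr2 (c z)) * S (pr2 (d z))))).
  split; [auto 12 with recf|intro z].
  rewrite val_code, <- H, <- H', !val_spec.
  replace (S (Nat.pred _)) with (S (pr2 (c z)) * S (pr2 (d z)))%nat by lia.
  rewrite !plus_INR, !mult_INR; field; split; apply not_0_INR; lia.
Qed.

Lemma recR_sub A B : recR A -> recR B -> recR (fun z => A z - B z).
Proof. intros; apply recR_add; auto using recR_opp. Qed.

(** Cross-multiplication, with the subtracted parts of the numerators moved to the other side,
    leaves an inequality between natural numbers. *)
Lemma decP_Rle A B : recR A -> recR B -> decP (fun z => A z <= B z).
Proof.
  intros (c & Hc & H) (d & Hd & H').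
  apply decP_ext with (fun z =>
   (pr1 (pr1 (c z)) * S (pr2 (d z)) + pr2 (pr1 (d z)) * S (pr2 (c z)) <=
    pr1 (pr1 (d z)) * S (pr2 (c z)) + pr2 (pr1 (c z)) * S (pr2 (d z)))%nat).
  - intro z; rewrite <- H, <- H', !val_spec.
    set (i := pr1 (pr1 (c z))); set (j := pr2 (pr1 (c z))).
    set (i' := pr1 (pr1 (d z))); set (j' := pr2 (pr1 (d z))).
    assert (Hk : 0 < INR (S (pr2 (c z)))) by (apply lt_0_INR; lia).
    assert (Hk' : 0 < INR (S (pr2 (d z)))) by (apply lt_0_INR; lia).
    assert (E : forall u v, u / INR (S (pr2 (c z))) <= v / INR (S (pr2 (d z))) <->
                u * INR (S (pr2 (d z))) <= v * INR (S (pr2 (c z)))).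
    { intros u v; split; intro Hle.
      - replace (u * _) with (u / INR (S (pr2 (c z))) *
          (INR (S (pr2 (c z))) * INR (S (pr2 (d z))))) by (field; lra).
        replace (v * _) with (v / INR (S (pr2 (d z))) *
          (INR (S (pr2 (c z))) * INR (S (pr2 (d z))))) by (field; lra).
        apply Rmult_le_compat_r; nra.
      - apply Rmult_le_reg_r with (INR (S (pr2 (c z))) * INR (S (pr2 (d z)))); [nra|].
        replace (u / _ * _) with (u * INR (S (pr2 (d z)))) by (field; lra).
        replace (v / _ * _) with (v * INR (S (pr2 (c z)))) by (field; lra).
        exact Hle. }
    rewrite E; split; intro Hle.
    + apply le_INR in Hle; rewrite !plus_INR, !mult_INR in Hle; lra.
    + apply INR_le; rewrite !plus_INR, !mult_INR; lra.
  - apply decP_le; auto 12 with recf.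
Qed.

Lemma decP_Rlt A B : recR A -> recR B -> decP (fun z => A z < B z).
Proof.
  intros HA HB; apply decP_ext with (fun z => ~ B z <= A z).
  - intro z; lra.
  - apply decP_not, decP_Rle; auto.
Qed.

(** * Use of the oracle *)

(** [track o s c] simulates [c] with the oracle whose value at [n] is computed by
    [o] from [(e, n)]; it maps [(e, x)] to the result of [c] on [x] paired with a
    strict bound on the positions queried.  [s] must compute addition. *)
Fixpoint track (o s c : code) : code :=
  let val c := Comp Fst c in
  let use c := Comp Snd c in
  let plus c d := Comp s (Pair c d) in
  match c with
  | Zero => Pair Zero Zero
  | Succ => Pair (Comp Succ Snd) Zero
  | Fst => Pair (Comp Fst Snd) Zero
  | Snd => Pair (Comp Snd Snd) Zero
  | Query => Pair o (Comp Succ Snd)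
  | Pair c d =>
      let A := track o s c in
      let B := track o s d in
      Pair (Pair (val A) (val B)) (plus (use A) (use B))
  | Comp c d =>
      let B := track o s d in
      let A := Comp (track o s c) (Pair Fst (val B)) in
      Pair (val A) (plus (use B) (use A))
  | PrimRec c d =>
      let env := Comp Fst Fst in
      let arg := Comp Snd Fst in
      let idx := Comp Fst Snd in
      let acc := Comp Snd Snd in
      let B := Comp (track o s d) (Pair env (Pair arg (Pair idx (Comp Fst acc)))) in
      Comp (PrimRec (track o s c) (Pair (val B) (plus (Comp Snd acc) (use B))))
           (Pair (Pair Fst (Comp Fst Snd)) (Comp Snd Snd))
  | Mu c =>
      let at_ k := Comp (track o s c) (Pair (Comp Fst Fst) (Pair (Comp Snd Fst) k)) in
      let Y := Mu (val (at_ Snd)) in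
      let U := PrimRec Zero (plus (Comp Snd Snd) (use (at_ (Comp Fst Snd)))) in
      Pair Y (Comp U (Pair (Pair Fst Snd) (Comp Succ Y)))
  end.

#[local] Hint Resolve eval_Fst eval_Snd eval_Pair : eval.
#[local] Hint Extern 2 (eval _ (Comp _ _) _ _) => eapply eval_Comp : eval.
#[local] Hint Extern 1 (eval _ Zero _ _) => reflexivity : eval.
#[local] Hint Extern 1 (eval _ Succ _ _) => reflexivity : eval.

Fixpoint partial_sum (w : nat -> nat) (n : nat) : nat :=
  match n with O => 0%nat | S k => (partial_sum w k + w k)%nat end.

Lemma partial_sum_term w n k : (k < n)%nat -> (w k <= partial_sum w n)%nat.
Proof.
  induction n as [|n IH]; [lia|]; intro Hk; simpl.
  destruct (Nat.eq_dec k n) as [->|]; [lia|].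
  specialize (IH ltac:(lia)); lia.
Qed.

Lemma bounded_choice (P : nat -> nat -> Prop) n :
  (forall k, (k < n)%nat -> exists u, P k u) ->
  exists w, forall k, (k < n)%nat -> P k (w k).
Proof.
  intro H; apply (choice (fun k u => (k < n)%nat -> P k u)); intro k.
  destruct (Nat.lt_decidable k n) as [Hk|Hk]; [|exists 0%nat; tauto].
  destruct (H k Hk) as [u Hu]; exists u; auto.
Qed.

(** The first clause is the continuity of the run: only the first [u] oracle values matter. The
    second asks [o] to agree with [phi] on these positions only, so a simulation on [e] reproduces
    any run whose oracle starts in the same way. *)
Definition tracked (o s : code) (phi : nat -> nat) (c : code) (x y u : nat) : Prop :=
  (forall phi', (forall n, (n < u)%nat -> phi' n = phi n) -> eval phi' c x y) /\
  (forall e, (forall n, (n < u)%nat -> eval zero_oracle o (to_nat (e, n)) (phi n)) ->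
     eval zero_oracle (track o s c) (to_nat (e, x)) (to_nat (y, u))).

(** Induction on the program. A halting run makes finitely many queries; the bounds of its subruns
    are added, a sum being a bound for each of its terms. *)
Lemma eval_tracked o s phi c :
  (forall a b, eval zero_oracle s (to_nat (a, b)) (a + b)%nat) ->
  forall x y, eval phi c x y -> exists u, tracked o s phi c x y u.
Proof.
  intro Hs.
  assert (Hplus : forall A B x a b,
    eval zero_oracle A x a -> eval zero_oracle B x b ->
    eval zero_oracle (Comp s (Pair A B)) x (a + b)%nat).
  { intros; eapply eval_Comp; eauto with eval. }
  induction c as [| | | | |c IHc d IHd|c IHc d IHd|c IHc d IHd|c IHc]; intros x y.
  - intros ->; exists 0%nat; split; [reflexivity|cbn [track]; eauto with eval].
  - intros ->; exists 0%nat; split; [reflexivity|cbn [track]; eauto with eval].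
  - intros ->; exists 0%nat; split; [reflexivity|intros; cbn [track]].
    apply eval_Pair; eauto with eval; eapply eval_Comp; eauto with eval; reflexivity.
  - intros ->; exists 0%nat; split; [reflexivity|intros; cbn [track]].
    apply eval_Pair; eauto with eval; eapply eval_Comp; eauto with eval; reflexivity.
  - intros ->; exists (S x); split.
    + intros phi' H; symmetry; apply H; lia.
    + intros e H; cbn [track]; apply eval_Pair; eauto with eval.
  - intros (a & b & Ha & Hb & ->).
    destruct (IHc _ _ Ha) as (u & Hu & Hu'), (IHd _ _ Hb) as (v & Hv & Hv').
    exists (u + v)%nat; split.
    + intros phi' H; apply eval_Pair; [apply Hu|apply Hv]; intros; apply H; lia.
    + intros e H; specialize (Hu' e); specialize (Hv' e).
      assert (E := Hu' ltac:(intros; apply H; lia)).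
      assert (E' := Hv' ltac:(intros; apply H; lia)).
      cbn [track]; apply eval_Pair; [|apply Hplus]; eauto with eval.
  - intros (a & Ha & Hy).
    destruct (IHd _ _ Ha) as (u & Hu & Hu'), (IHc _ _ Hy) as (v & Hv & Hv').
    exists (u + v)%nat; split.
    + intros phi' H; eapply eval_Comp; [apply Hu|apply Hv]; intros; apply H; lia.
    + intros e H; specialize (Hu' e); specialize (Hv' e).
      assert (E := Hu' ltac:(intros; apply H; lia)).
      assert (E' := Hv' ltac:(intros; apply H; lia)).
      cbn [track]; apply eval_Pair; [|apply Hplus]; eauto 6 with eval.
  - intros (h & H0 & Hd & ->).
    destruct (IHc _ _ H0) as (u & Hu & Hu').
    destruct (bounded_choice (fun k =>
      tracked o s phi d (to_nat (fst (of_nat x), to_nat (k, h k))) (h (S k)))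
      (snd (of_nat x))) as [w Hw]; [auto|].
    rewrite <- (cancel_to_of x); destruct (of_nat x) as [a n]; cbn [fst snd] in *.
    rewrite cancel_of_to; cbn [snd].
    exists (u + partial_sum w n)%nat; split.
    + intros phi' H; apply eval_PrimRec; [apply Hu; intros; apply H; lia|].
      intros k Hk; apply (Hw k Hk); intros i Hi; apply H.
      pose proof (partial_sum_term w n k Hk); lia.
    + intros e H; cbn [track]; eapply eval_Comp.
      { apply eval_Pair; [apply eval_Pair|]; eauto with eval. }
      (* The simulated recursion carries the current value together with the bound accumulated so
         far. *)
      apply eval_PrimRec with (h := fun k => to_nat (h k, (u + partial_sum w k)%nat)).
      * simpl partial_sum; rewrite Nat.add_0_r; apply Hu'; intros; apply H; lia.
      * intros k Hk; destruct (Hw k Hk) as [_ E]; specialize (E e).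
        assert (E' := E ltac:(intros; apply H;
          pose proof (partial_sum_term w n k Hk); lia)).
        assert (EB : eval zero_oracle (Comp (track o s d) (Pair (Comp Fst Fst)
          (Pair (Comp Snd Fst) (Pair (Comp Fst Snd) (Comp Fst (Comp Snd Snd))))))
          (to_nat (to_nat (e, a), to_nat (k, to_nat (h k, (u + partial_sum w k)%nat))))
          (to_nat (h (S k), w k))).
        { eapply eval_Comp; [|exact E'].
          repeat apply eval_Pair; repeat (eapply eval_Comp; eauto with eval). }
        cbn [partial_sum]; rewrite Nat.add_assoc.
        apply eval_Pair; [eauto with eval|apply Hplus; [|eauto with eval]].
        repeat (eapply eval_Comp; eauto with eval).
  - intros (Hy & Hk).
    (* The trace of the search: the values at 0, ..., [y], of which only the last is zero. *)
    destruct (bounded_choice (fun k v => eval phi c (to_nat (x, k)) v /\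
      (k = y -> v = 0%nat) /\ (k <> y -> v <> 0%nat)) (S y)) as [v Hv].
    { intros k Hlt; destruct (Nat.eq_dec k y) as [->|Hne].
      - exists 0%nat; repeat split; auto; tauto.
      - destruct (Hk k ltac:(lia)) as [v Hv]; exists (S v); repeat split; auto; lia. }
    destruct (bounded_choice (fun k => tracked o s phi c (to_nat (x, k)) (v k)) (S y))
      as [w Hw]; [intros k Hlt; apply IHc; now apply Hv|].
    exists (partial_sum w (S y)); split.
    + intros phi' H.
      assert (E : forall k, (k < S y)%nat -> eval phi' c (to_nat (x, k)) (v k)).
      { intros k Hlt; apply (Hw k Hlt); intros i Hi; apply H.
        pose proof (partial_sum_term w (S y) k Hlt); lia. }
      apply eval_Mu with v; auto; [|intros k Hlt]; apply Hv; lia.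
    + intros e H.
      assert (E : forall k, (k < S y)%nat -> eval zero_oracle (track o s c)
        (to_nat (e, to_nat (x, k))) (to_nat (v k, w k))).
      { intros k Hlt; apply (Hw k Hlt); intros i Hi; apply H.
        pose proof (partial_sum_term w (S y) k Hlt); lia. }
      (* The simulated search sees only the values. The bounds for 0, ..., [y] are summed afterwards
         by a separate recursion of length [S y]. *)
      assert (EY : eval zero_oracle (Mu (Comp Fst (Comp (track o s c)
        (Pair (Comp Fst Fst) (Pair (Comp Snd Fst) Snd))))) (to_nat (e, x)) y).
      { assert (Ev : forall k, (k < S y)%nat -> eval zero_oracle (Comp Fst
          (Comp (track o s c) (Pair (Comp Fst Fst) (Pair (Comp Snd Fst) Snd))))
          (to_nat (to_nat (e, x), k)) (v k)).
        { intros k Hlt; eapply eval_Comp; [|apply eval_Fst].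
          eapply eval_Comp; [|apply (E k Hlt)].
          repeat apply eval_Pair; eauto with eval. }
        apply eval_Mu with v; auto; [|intros k Hlt]; apply Hv; lia. }
      cbn [track]; apply eval_Pair; [exact EY|].
      eapply eval_Comp.
      { apply eval_Pair; [apply eval_Pair; [apply eval_Fst|apply eval_Snd]|].
        eapply eval_Comp; [exact EY|reflexivity]. }
      apply eval_PrimRec; [reflexivity|].
      intros k Hlt; cbn [partial_sum]; apply Hplus.
      * repeat (eapply eval_Comp; eauto with eval).
      * eapply eval_Comp; [|apply eval_Snd].
        eapply eval_Comp; [|apply (E k Hlt)].
        repeat apply eval_Pair; repeat (eapply eval_Comp; eauto with eval).
Qed.

(** * Approximation of a computable path on dyadic cells *)

Lemma half_pow_pos n : 0 < (/ 2) ^ n.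
Proof. apply pow_lt; lra. Qed.

Lemma half_pow_le m n : (m <= n)%nat -> (/ 2) ^ n <= (/ 2) ^ m.
Proof.
  induction 1 as [|n _ IH]; [lra|]; simpl; pose proof (half_pow_pos n); lra.
Qed.

Lemma half_pow_small e : 0 < e -> exists n, forall m, (n <= m)%nat -> (/ 2) ^ m < e.
Proof.
  intro He; destruct (pow_lt_1_zero (/ 2)) with (y := e) as [N HN]; auto.
  - rewrite Rabs_pos_eq; lra.
  - exists N; intros m Hm; specialize (HN m Hm).
    rewrite Rabs_pos_eq in HN; auto; apply Rlt_le, half_pow_pos.
Qed.

Lemma pow2_half_pow n : 2 ^ n * (/ 2) ^ n = 1.
Proof. rewrite <- Rpow_mult_distr, Rinv_r, pow1; lra. Qed.

Definition nat_floor (y : R) : nat := Z.to_nat (Int_part y).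

Lemma nat_floor_spec y : 0 <= y -> INR (nat_floor y) <= y < INR (nat_floor y) + 1.
Proof.
  intro Hy; destruct (base_Int_part y) as [H1 H2]; unfold nat_floor.
  rewrite INR_IZR_INZ, Z2Nat.id; [lra|].
  apply Z.lt_succ_r, lt_IZR; rewrite succ_IZR; lra.
Qed.

Lemma nat_floor_unique y n : INR n <= y < INR n + 1 -> nat_floor y = n.
Proof.
  intros H; assert (Hy : 0 <= y) by (pose proof (pos_INR n); lra).
  pose proof (nat_floor_spec y Hy) as Hf.
  assert (nat_floor y < S n)%nat by (apply INR_lt; rewrite S_INR; lra).
  assert (n < S (nat_floor y))%nat by (apply INR_lt; rewrite S_INR; lra).
  lia.
Qed.

Definition dyadic (m i : nat) : R := INR i * (/ 2) ^ m.

Lemma dyadic_nonneg m i : 0 <= dyadic m i.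
Proof. apply Rmult_le_pos; [apply pos_INR|apply Rlt_le, half_pow_pos]. Qed.

Lemma dyadic_S m i : dyadic m (S i) = dyadic m i + (/ 2) ^ m.
Proof. unfold dyadic; rewrite S_INR; ring. Qed.

Lemma dyadic_le m i j : (i <= j)%nat -> dyadic m i <= dyadic m j.
Proof.
  intro H; apply Rmult_le_compat_r; [apply Rlt_le, half_pow_pos|now apply le_INR].
Qed.

Lemma dyadic_lt_inv m i j : dyadic m i < dyadic m j -> (i < j)%nat.
Proof.
  intro H; apply INR_lt; apply Rmult_lt_reg_r with ((/ 2) ^ m); auto using half_pow_pos.
Qed.

Lemma dyadic_full m : dyadic m (2 ^ m) = 1.
Proof. unfold dyadic; rewrite INR_pow2; apply pow2_half_pow. Qed.

Lemma dyadic_floor m y :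
  0 <= y -> dyadic m (nat_floor (y * 2 ^ m)) <= y < dyadic m (S (nat_floor (y * 2 ^ m))).
Proof.
  intro Hy; pose proof (half_pow_pos m) as Hm; pose proof (pow2_half_pow m) as Hp.
  assert (H : 0 <= y * 2 ^ m) by (apply Rmult_le_pos; auto; apply pow_le; lra).
  apply nat_floor_spec in H; unfold dyadic; rewrite S_INR.
  assert (E : y = y * 2 ^ m * (/ 2) ^ m) by (rewrite Rmult_assoc, Hp; ring).
  split; [rewrite E at 2|rewrite E at 1]; nra.
Qed.

Lemma dyadic_le_full m i : dyadic m i <= 1 -> (i <= 2 ^ m)%nat.
Proof.
  intro H; rewrite <- (dyadic_full m) in H; apply INR_le.
  apply Rmult_le_reg_r with ((/ 2) ^ m); auto using half_pow_pos.
Qed.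

Lemma dyadic_refine k m i : (k <= m)%nat -> dyadic m (i * 2 ^ (m - k)) = dyadic k i.
Proof.
  intro H; unfold dyadic; rewrite mult_INR, INR_pow2.
  replace ((/ 2) ^ m) with ((/ 2) ^ k * (/ 2) ^ (m - k))
    by (rewrite <- pow_add; f_equal; lia).
  transitivity (INR i * (/ 2) ^ k * (2 ^ (m - k) * (/ 2) ^ (m - k))); [ring|].
  rewrite pow2_half_pow; ring.
Qed.

(** Entry [k] truncates at level [S k], which uses up only half of the error allowed in a Cauchy
    name. *)
Definition floor_name (y : R) (k : nat) : nat :=
  to_nat (to_nat (nat_floor (y * 2 ^ S k), 0%nat), Nat.pred (2 ^ S k)).

Lemma val_floor_name y k : val (floor_name y k) = dyadic (S k) (nat_floor (y * 2 ^ S k)).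
Proof.
  unfold floor_name, dyadic; rewrite val_code, S_pred_pow2, INR_pow2, pow_inv.
  simpl (INR 0); field; apply pow_nonzero; lra.
Qed.

Lemma val_floor_name_near y k : 0 <= y -> Rabs (val (floor_name y k) - y) <= (/ 2) ^ S k.
Proof.
  intro Hy; rewrite val_floor_name; pose proof (dyadic_floor (S k) y Hy) as H.
  rewrite dyadic_S in H; apply Rabs_le; lra.
Qed.

Lemma cauchy_floor_name y : 0 <= y -> cauchy_name (floor_name y) y.
Proof.
  intros Hy n; eapply Rle_trans; [now apply val_floor_name_near|].
  apply half_pow_le; lia.
Qed.

(** The first [u] entries of the floor name of [y] have precision to spare, and
    hence begin a name of every point close enough to [y]. *)
Lemma cauchy_name_splice x y u :
  0 <= x -> 0 <= y -> Rabs (x - y) <= (/ 2) ^ S u ->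
  exists phi, cauchy_name phi x /\ forall n, (n < u)%nat -> phi n = floor_name y n.
Proof.
  intros Hx Hy Hxy.
  exists (fun n => if Nat.ltb n u then floor_name y n else floor_name x n); split.
  - intro n; destruct (Nat.ltb_spec n u) as [Hn|Hn]; [|now apply cauchy_floor_name].
    fold (val (floor_name y n)).
    pose proof (val_floor_name_near y n Hy); pose proof (half_pow_le (S n) (S u)).
    replace (val (floor_name y n) - x) with ((val (floor_name y n) - y) - (x - y)) by ring.
    eapply Rle_trans; [apply Rabs_triang|]; rewrite Rabs_Ropp.
    specialize (H0 ltac:(lia)); simpl in *; lra.
  - intros n Hn; apply Nat.ltb_lt in Hn; now rewrite Hn.
Qed.

(** Truncation at a finer level does not move a point across a coarser grid point. Hence a dyadic
    truncation of [y] shares an initial part of its floor name with [y]. *)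
Lemma nat_floor_truncate y k M :
  0 <= y -> (k <= M)%nat ->
  nat_floor (dyadic M (nat_floor (y * 2 ^ M)) * 2 ^ k) = nat_floor (y * 2 ^ k).
Proof.
  intros Hy HkM; set (b := nat_floor (y * 2 ^ M)); set (a := nat_floor (y * 2 ^ k)).
  assert (Ha : dyadic k a <= y < dyadic k (S a)) by now apply dyadic_floor.
  assert (Hb : dyadic M b <= y < dyadic M (S b)) by now apply dyadic_floor.
  apply nat_floor_unique.
  assert (H1 : dyadic k a <= dyadic M b).
  { rewrite <- (dyadic_refine k M) by auto; apply dyadic_le.
    assert (H : dyadic M (a * 2 ^ (M - k)) < dyadic M (S b)) by (rewrite dyadic_refine; auto; lra).
    apply dyadic_lt_inv in H; lia. }
  assert (H2 : dyadic M b < dyadic k (S a)) by lra.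
  assert (E' : forall i, dyadic k i * 2 ^ k = INR i).
  { intro i; unfold dyadic; rewrite Rmult_assoc, (Rmult_comm ((/ 2) ^ k)), pow2_half_pow; ring. }
  assert (Hp : 0 < 2 ^ k) by (apply pow_lt; lra).
  rewrite <- (E' a) at 1; rewrite <- S_INR, <- (E' (S a)); nra.
Qed.

(** A code [(m, i)] stands for the dyadic number [i / 2 ^ m], truncated at [1]. *)
Definition grid_point (e : nat) : R := dyadic (pr1 e) (Nat.min (pr2 e) (2 ^ pr1 e)).

Lemma grid_point_range e : 0 <= grid_point e <= 1.
Proof.
  unfold grid_point; split; [apply dyadic_nonneg|].
  rewrite <- (dyadic_full (pr1 e)); apply dyadic_le; lia.
Qed.

(** For a dyadic point the floor is a quotient of natural numbers, hence computable; floors of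
    arbitrary reals are not. *)
Lemma recf_floor_name : recf (fun w => floor_name (grid_point (pr1 w)) (pr2 w)).
Proof.
  apply recf_ext with (fun w => to_nat (to_nat
    ((Nat.min (pr2 (pr1 w)) (2 ^ pr1 (pr1 w)) * 2 ^ S (pr2 w)) / 2 ^ pr1 (pr1 w), 0),
    Nat.pred (2 ^ S (pr2 w)))%nat).
  - intro w; unfold floor_name, grid_point.
    set (m := pr1 (pr1 w)); set (i := Nat.min _ _); set (k := S (pr2 w)).
    do 4 f_equal; symmetry; apply nat_floor_unique.
    assert (Hm : (2 ^ m <> 0)%nat) by now apply Nat.pow_nonzero.
    pose proof (Nat.div_mod_eq (i * 2 ^ k) (2 ^ m)) as Hd.
    pose proof (Nat.mod_upper_bound (i * 2 ^ k) (2 ^ m) Hm) as Hr.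
    set (d := ((i * 2 ^ k) / 2 ^ m)%nat) in *; set (r := ((i * 2 ^ k) mod 2 ^ m)%nat) in *.
    assert (Hp := pow2_half_pow m); assert (H := half_pow_pos m).
    apply (f_equal INR) in Hd; apply lt_INR in Hr; pose proof (pos_INR r).
    rewrite plus_INR, !mult_INR, !INR_pow2 in Hd; rewrite INR_pow2 in Hr.
    unfold dyadic.
    replace (INR i * (/ 2) ^ m * 2 ^ k) with (INR d * (2 ^ m * (/ 2) ^ m) + INR r * (/ 2) ^ m)
      by (transitivity ((INR i * 2 ^ k) * (/ 2) ^ m); [rewrite Hd|]; ring).
    rewrite Hp; split; nra.
  - apply recf_pair; auto with recf; apply recf_pair; auto with recf.
    apply recf_div; auto 10 with recf; intro z; pose proof (Nat.pow_nonzero 2 (pr1 (pr1 z))); lia.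
Qed.

(** [F] runs the tracked machine on the floor name of a grid point and returns the approximations
    with the bound [u] on the queries. By splicing names, the output stays valid within
    [(/ 2) ^ S u] of that point. The last clause bounds [u] near any given [y]: at each fine level
    some grid point equals a truncation of [y] whose run is that of [y] itself. *)
Lemma path_functional f : computable_path f ->
  exists F, recf F /\
    (forall e n x, 0 <= x <= 1 ->
       Rabs (x - grid_point e) <= (/ 2) ^ S (pr2 (F (to_nat (e, n)))) ->
       Rabs (val (pr1 (pr1 (F (to_nat (e, n))))) - fst (f x)) <= (/ 2) ^ n /\
       Rabs (val (pr2 (pr1 (F (to_nat (e, n))))) - snd (f x)) <= (/ 2) ^ n) /\
    (forall n y, 0 <= y <= 1 -> exists M, forall m, (M <= m)%nat -> exists i,
       (i <= 2 ^ m)%nat /\ Rabs (dyadic m i - y) <= (/ 2) ^ M /\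
       (3 + pr2 (F (to_nat (to_nat (m, i), n))) <= M)%nat).
Proof.
  intros [c Hc].
  destruct recf_floor_name as [o Ho].
  assert (Hs : recf (fun w => (pr1 w + pr2 w)%nat)) by auto with recf.
  destruct Hs as [s Hs].
  assert (Hs' : forall a b, eval zero_oracle s (to_nat (a, b)) (a + b)%nat).
  { intros a b; specialize (Hs (to_nat (a, b))); cbn beta in Hs; now rewrite cancel_of_to in Hs. }
  assert (Ho' : forall e k, eval zero_oracle o (to_nat (e, k)) (floor_name (grid_point e) k)).
  { intros e k; specialize (Ho (to_nat (e, k))); cbn beta in Ho; now rewrite cancel_of_to in Ho. }
  assert (HF : forall z, exists v, eval zero_oracle (track o s c) z v).
  { intro z; rewrite <- (cancel_to_of z); destruct (of_nat z) as [e n].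
    pose proof (grid_point_range e) as He.
    destruct (Hc _ (floor_name (grid_point e)) He) as (psi & Hpsi & _).
    { apply cauchy_floor_name, He. }
    destruct (eval_tracked o s _ c Hs' _ _ (Hpsi n)) as (u & _ & Hu).
    exists (to_nat (psi n, u)); apply Hu; auto. }
  apply choice in HF; destruct HF as [F HF]; exists F; split; [now exists (track o s c)|].
  split.
  - intros e n x Hx Hxe; pose proof (grid_point_range e) as He.
    destruct (Hc _ (floor_name (grid_point e)) He) as (psi & Hpsi & _).
    { apply cauchy_floor_name, He. }
    destruct (eval_tracked o s _ c Hs' _ _ (Hpsi n)) as (u & Hu1 & Hu2).
    assert (E : F (to_nat (e, n)) = to_nat (psi n, u)).
    { eapply eval_functional; [apply HF|apply Hu2; auto]. }
    rewrite E, cancel_of_to in *; cbn [fst snd] in *.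
    destruct (cauchy_name_splice x (grid_point e) u) as (phi & Hphi & Hagree);
      [lra|lra|assumption|].
    destruct (Hc x phi Hx Hphi) as (psi' & Hpsi' & H1 & H2).
    assert (E' : psi' n = psi n) by (eapply eval_functional; [apply Hpsi'|auto]).
    specialize (H1 n); specialize (H2 n); cbn beta in H1, H2; rewrite E' in H1, H2; auto.
  - intros n y Hy.
    destruct (Hc _ (floor_name y) Hy) as (psi & Hpsi & _).
    { apply cauchy_floor_name, Hy. }
    destruct (eval_tracked o s _ c Hs' _ _ (Hpsi n)) as (u & _ & Hu).
    exists (3 + u)%nat; intros m Hm; set (M := (3 + u)%nat) in *.
    set (b := nat_floor (y * 2 ^ M)).
    pose proof (dyadic_floor M y ltac:(lra)) as Hb; fold b in Hb.
    assert (E : dyadic m (b * 2 ^ (m - M)) = dyadic M b) by now apply dyadic_refine.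
    assert (Hle : (b * 2 ^ (m - M) <= 2 ^ m)%nat) by (apply dyadic_le_full; lra).
    exists (b * 2 ^ (m - M))%nat; split; [exact Hle|split].
    + rewrite E; rewrite dyadic_S in Hb; apply Rabs_le; lra.
    + set (e := to_nat (m, (b * 2 ^ (m - M))%nat)).
      assert (Eg : grid_point e = dyadic M b).
      { unfold grid_point, e; rewrite cancel_of_to; cbn [fst snd].
        now rewrite Nat.min_l. }
      assert (EF : F (to_nat (e, n)) = to_nat (psi n, u)).
      { eapply eval_functional; [apply HF|apply Hu].
        intros k Hk; replace (floor_name y k) with (floor_name (grid_point e) k); auto.
        unfold floor_name; rewrite Eg; unfold b; rewrite nat_floor_truncate; auto; [lra|].
        unfold M; lia. }
      rewrite EF, cancel_of_to; cbn [snd]; lia.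
Qed.

(** * Uniform approximation on cells *)

Lemma recR_dyadic M A : recf M -> recf A -> recR (fun z => dyadic (M z) (A z)).
Proof. intros; apply recR_mul; auto using recR_INR, recR_half_pow. Qed.

(** [j = 2 ^ m] is allowed: that cell is the single point [1]. *)
Definition in_cell (m j : nat) (x : R) : Prop :=
  (j <= 2 ^ m)%nat /\ 0 <= x <= 1 /\ dyadic m j <= x <= dyadic m (S j).

Lemma in_cell_floor m x : 0 <= x <= 1 -> in_cell m (nat_floor (x * 2 ^ m)) x.
Proof.
  intro Hx; pose proof (dyadic_floor m x ltac:(lra)); repeat split; try lra.
  apply dyadic_le_full; lra.
Qed.

(** For each precision a level is searched at which every cell lies in the validity range of some
    grid point; the output there serves the whole cell. Compactness is used only to show that the
    search ends. *)
Lemma path_cells f : computable_path f ->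
  exists m X Y, recf m /\ recR X /\ recR Y /\ (forall n, (n <= m n)%nat) /\
    forall n j x, in_cell (m n) j x ->
      Rabs (X (to_nat (n, j)) - fst (f x)) <= (/ 2) ^ n /\
      Rabs (Y (to_nat (n, j)) - snd (f x)) <= (/ 2) ^ n.
Proof.
  intro Hf; destruct (path_functional f Hf) as (F & HF & Happrox & Hlocal).
  set (use := fun n m i => pr2 (F (to_nat (to_nat (m, i), n)))).
  (* Rational inequalities which put the whole cell [j] into the validity range of the grid point
     [i]. *)
  set (near := fun n m j i => (i <= 2 ^ m)%nat /\
    dyadic m j + (/ 2) ^ m <= dyadic m i + (/ 2) ^ S (use n m i) /\
    dyadic m i + (/ 2) ^ m <= dyadic m j + (/ 2) ^ S (use n m i)).
  assert (Huse : forall N M I, recf N -> recf M -> recf I ->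
                 recf (fun z => use (N z) (M z) (I z))).
  { intros N M I HN HM HI; unfold use; apply recf_pr2.
    apply (recf_comp F); auto with recf. }
  assert (Hnear : forall N M J I, recf N -> recf M -> recf J -> recf I ->
                 decP (fun z => near (N z) (M z) (J z) (I z))).
  { intros N M J I HN HM HJ HI; unfold near.
    repeat apply decP_and; [apply decP_le; auto with recf|..];
      apply decP_Rle; apply recR_add; auto using recR_dyadic, recR_half_pow, recf_S. }
  assert (Hcover : forall n, exists m, (n <= m)%nat /\
    forall j, (j <= 2 ^ m)%nat -> exists i, (i <= 2 ^ m)%nat /\ near n m j i).
  { intro n.
    assert (HM : forall y, exists M, 0 <= y <= 1 -> forall m, (M <= m)%nat -> exists i,
       (i <= 2 ^ m)%nat /\ Rabs (dyadic m i - y) <= (/ 2) ^ M /\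
       (3 + use n m i <= M)%nat).
    { intro y; destruct (classic (0 <= y <= 1)) as [Hy|Hy]; [|exists 0%nat; tauto].
      destruct (Hlocal n y Hy) as [M HM]; exists M; auto. }
    apply choice in HM; destruct HM as [M HM].
    (* The number [d] is a uniform lower bound for the radii needed: each point is within
       [(/ 2) ^ M y] of some [y] with [d <= (/ 2) ^ M y]. A level with cells shorter than [d] is
       then fine enough for that [y]. *)
    destruct (compactness_value_1d 0 1 (fun y => mkposreal _ (half_pow_pos (M y))))
      as [d Hd]; simpl in Hd.
    destruct (half_pow_small d (cond_pos d)) as [m0 Hm0].
    exists (Nat.max n m0); split; [lia|]; set (m := Nat.max n m0); intros j Hj.
    assert (Hj01 : 0 <= dyadic m j <= 1).
    { split; [apply dyadic_nonneg|rewrite <- (dyadic_full m); now apply dyadic_le]. }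
    apply NNPP; intro Hno; apply (Hd _ Hj01); intros (y & Hy & Hyj & Hdy); apply Hno.
    assert (Hmd := Hm0 m ltac:(lia)).
    assert (HMm : (M y <= m)%nat).
    { destruct (Nat.le_gt_cases (M y) m) as [|Hlt]; auto.
      pose proof (half_pow_le m (M y)) as Hp; specialize (Hp ltac:(lia)); lra. }
    destruct (HM y Hy m HMm) as (i & Hi & Hiy & Hu); exists i; split; auto.
    (* The distances from [j] to [y] and from [y] to [i] and the cell length add up to at most
       [3 * (/ 2) ^ M y], whereas the margin 3 makes the validity radius at least
       [4 * (/ 2) ^ M y]. *)
    pose proof (half_pow_le _ _ HMm); pose proof (half_pow_le _ _ Hu) as Hp.
    simpl in Hp; apply Rabs_def2 in Hyj.
    apply Rabs_le_between in Hiy; pose proof (half_pow_pos (M y)).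
    unfold near; simpl; repeat split; auto; lra. }
  destruct (recf_search (fun n m => (n <= m)%nat /\
    forall j, (j <= 2 ^ m)%nat -> exists i, (i <= 2 ^ m)%nat /\ near n m j i))
    as (m & Hm & Hcov); [|exact Hcover|].
  { apply decP_and; [apply decP_le; auto with recf|].
    apply (decP_forall (fun z j => exists i, (i <= 2 ^ pr2 z)%nat /\ near (pr1 z) (pr2 z) j i)
      (fun z => (2 ^ pr2 z)%nat)); [|auto with recf].
    apply (decP_exists (fun w i => near (pr1 (pr1 w)) (pr2 (pr1 w)) (pr2 w) i)
      (fun w => (2 ^ pr2 (pr1 w))%nat)); [|auto with recf].
    apply Hnear; auto 6 with recf. }
  (* The premise makes the search total: indices beyond the grid get the default 0. *)
  destruct (recf_search (fun z i => (pr2 z <= 2 ^ m (pr1 z))%nat ->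
    near (pr1 z) (m (pr1 z)) (pr2 z) i)) as (I & HI & HnearI).
  { apply decP_imp; [apply decP_le|apply Hnear]; auto using recf_comp with recf. }
  { intro z; destruct (Nat.le_gt_cases (pr2 z) (2 ^ m (pr1 z))) as [Hz|Hz].
    - destruct (proj2 (Hcov (pr1 z)) _ Hz) as (i & _ & Hi); exists i; auto.
    - exists 0%nat; lia. }
  set (V := fun z => pr1 (F (to_nat (to_nat (m (pr1 z), I z), pr1 z)))).
  assert (HV : recf V).
  { unfold V; apply recf_pr1, recf_comp; auto using recf_comp with recf. }
  exists m, (fun z => val (pr1 (V z))), (fun z => val (pr2 (V z))).
  repeat split; auto using recR_val with recf; [intro; apply Hcov|..];
    specialize (HnearI (to_nat (n, j))); rewrite cancel_of_to in HnearI; cbn [fst snd] in *;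
    destruct H as (Hj & Hx & Hjx); destruct (HnearI Hj) as (Hi & H1 & H2);
    unfold V; rewrite cancel_of_to; cbn [fst snd]; apply Happrox; auto;
    unfold grid_point; rewrite cancel_of_to; cbn [fst snd];
    rewrite Nat.min_l by auto; fold (use n (m n) (I (to_nat (n, j))));
    rewrite dyadic_S in Hjx; apply Rabs_le; lra.
Qed.

(** * Continuity and exit points *)

Definition continuous01 (H : R -> R) : Prop :=
  forall x e, 0 <= x <= 1 -> 0 < e -> exists d, 0 < d /\
    forall y, 0 <= y <= 1 -> Rabs (y - x) < d -> Rabs (H y - H x) < e.

Definition cell_approx (m : nat -> nat) (V : nat -> R) (H : R -> R) : Prop :=
  forall n j x, in_cell (m n) j x -> Rabs (V (to_nat (n, j)) - H x) <= (/ 2) ^ n.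

(** The two points lie in the same cell or in adjacent ones. Cells are closed, so in the second case
    their common endpoint links both approximations, at the cost of four errors. *)
Lemma cell_approx_modulus m V H n x y :
  cell_approx m V H -> 0 <= x -> x <= y -> y <= 1 -> y - x < (/ 2) ^ m n ->
  Rabs (H y - H x) <= 4 * (/ 2) ^ n.
Proof.
  intros HV Hx Hxy Hy Hd.
  assert (Hj := in_cell_floor (m n) x ltac:(lra)).
  set (j := nat_floor (x * 2 ^ m n)) in *.
  pose proof (HV _ _ _ Hj) as Ex; apply Rabs_le_between in Ex.
  destruct Hj as (Hj & _ & Hjx).
  destruct (Rle_or_lt y (dyadic (m n) (S j))) as [Hyj|Hyj].
  - assert (Ey := HV n j y); apply Rabs_le_between in Ey;
      [|repeat split; auto; lra].
    pose proof (half_pow_pos n); apply Rabs_le; lra.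
  - set (b := dyadic (m n) (S j)) in *.
    assert (Sj : (S j <= 2 ^ m n)%nat).
    { apply dyadic_le_full; fold b; lra. }
    assert (Eb := HV n j b); apply Rabs_le_between in Eb;
      [|repeat split; auto; unfold b in *; lra].
    assert (Eb' := HV n (S j) b); apply Rabs_le_between in Eb';
      [|repeat split; auto; rewrite ?(dyadic_S _ (S j)); fold b;
        pose proof (half_pow_pos (m n)); lra].
    assert (Ey := HV n (S j) y); apply Rabs_le_between in Ey;
      [|repeat split; auto; rewrite ?(dyadic_S _ (S j)); fold b; lra].
    apply Rabs_le; lra.
Qed.

Lemma cell_approx_continuous m V H : cell_approx m V H -> continuous01 H.
Proof.
  intros HV x e Hx He; destruct (half_pow_small (e / 4)) as [n Hn]; [lra|].
  specialize (Hn n (le_n n)); exists ((/ 2) ^ m n); split; [apply half_pow_pos|].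
  intros y Hy Hxy; apply Rabs_def2 in Hxy; destruct (Rle_or_lt x y).
  - eapply Rle_lt_trans; [apply (cell_approx_modulus m V H n)|]; auto; lra.
  - rewrite Rabs_minus_sym.
    eapply Rle_lt_trans; [apply (cell_approx_modulus m V H n)|]; auto; lra.
Qed.

Lemma continuous01_reflect H : continuous01 H -> continuous01 (fun x => H (1 - x)).
Proof.
  intros HH x e Hx He; destruct (HH (1 - x) e) as (d & Hd & Hc); [lra|auto|].
  exists d; split; auto; intros y Hy Hxy; apply Hc; [lra|].
  replace (1 - y - (1 - x)) with (- (y - x)) by ring; now rewrite Rabs_Ropp.
Qed.

(** The point is the supremum of the arguments up to [a] at which [H] reaches [T]; by continuity the
    level is reached there. *)
Lemma last_exit H a T :
  continuous01 H -> 0 <= a <= 1 -> H a < T -> T <= H 0 ->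
  exists x, 0 <= x < a /\ T <= H x /\ forall z, x < z <= a -> H z < T.
Proof.
  intros HH Ha HaT H0.
  destruct (completeness (fun z => 0 <= z <= a /\ T <= H z)) as (x & Hub & Hlub).
  - exists a; intros z Hz; lra.
  - exists 0; lra.
  - assert (Hx : 0 <= x <= a).
    { split; [apply Hub; lra|apply Hlub; intros z Hz; lra]. }
    assert (HTx : T <= H x).
    { apply Rnot_lt_le; intro Hlt.
      destruct (HH x (T - H x)) as (d & Hd & Hc); [lra|lra|].
      assert (Hle : x <= x - d); [|lra].
      apply Hlub; intros z [Hz HTz]; apply Rnot_lt_le; intro Hzd.
      assert (z <= x) by (apply Hub; auto).
      assert (Hzx : Rabs (z - x) < d) by (apply Rabs_def1; lra).
      apply Hc in Hzx; [apply Rabs_def2 in Hzx; lra|lra]. }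
    exists x; split; [|split; [exact HTx|]].
    + split; [lra|]; destruct (Rle_lt_or_eq_dec x a) as [|E]; [lra|auto|].
      rewrite E in HTx; lra.
    + intros z Hz; apply Rnot_le_lt; intro HTz.
      assert (z <= x) by (apply Hub; lra); lra.
Qed.

(** [x] is the last point before [a], and [y] the first one after [a], at which [H]
    reaches the level [T]. *)
Definition exits (H : R -> R) (a T x y : R) : Prop :=
  0 <= x < a /\ a < y <= 1 /\ T <= H x /\ T <= H y /\ forall z, x < z < y -> H z < T.

Lemma exits_exist H a T :
  continuous01 H -> 0 <= a <= 1 -> H a < T -> T <= H 0 -> T <= H 1 ->
  exists x y, exits H a T x y.
Proof.
  intros HH Ha HaT H0 H1.
  destruct (last_exit H a T HH Ha HaT H0) as (x & Hx & HTx & Hxa).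
  (* Reflection of the unit interval turns the first exit after [a] into a last exit. *)
  destruct (last_exit (fun x => H (1 - x)) (1 - a) T) as (y & Hy & HTy & Hya);
    [now apply continuous01_reflect|lra|..].
  - now replace (1 - (1 - a)) with a by ring.
  - now rewrite Rminus_0_r.
  - exists x, (1 - y); unfold exits; repeat split; try lra.
    intros z Hz; destruct (Rle_or_lt z a); [apply Hxa; lra|].
    replace z with (1 - (1 - z)) by ring; apply Hya; lra.
Qed.

(** Strictly between [x] and [y] the function stays below [T], so it cannot reach the higher level
    [T'] there. *)
Lemma exits_monotone H a T T' x y x' y' :
  exits H a T x y -> exits H a T' x' y' -> T <= T' -> x' <= x /\ y <= y'.
Proof.
  intros (Hx & Hy & HTx & HTy & Hin) (Hx' & Hy' & HTx' & HTy' & Hin') HT.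
  split; apply Rnot_lt_le; intro Hlt.
  - specialize (Hin x'); lra.
  - specialize (Hin y'); lra.
Qed.

(** Between two levels, the total displacement of the exit points is bounded by 2,
    so some subinterval of levels displaces them arbitrarily little. *)
Lemma exits_gap H a t1 t2 d :
  0 <= t1 < t2 -> 0 < d ->
  (forall t, t1 <= t <= t2 -> exists x y, exits H a (t * t) x y) ->
  exists u v x y x' y', t1 <= u /\ u < v /\ v <= t2 /\
    exits H a (u * u) x y /\ exits H a (v * v) x' y' /\ x - x' < d /\ y' - y < d.
Proof.
  intros Ht Hd Hex.
  assert (Hxy : exists E : R -> R * R, forall t, t1 <= t <= t2 ->
                exits H a (t * t) (fst (E t)) (snd (E t))).
  { apply (choice (fun t w => t1 <= t <= t2 -> exits H a (t * t) (fst w) (snd w))).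
    intro t; destruct (classic (t1 <= t <= t2)) as [Hr|Hr]; [|exists (0, 0); tauto].
    destruct (Hex t Hr) as (x & y & Hxy); exists (x, y); auto. }
  destruct Hxy as [E HE].
  destruct (INR_unbounded (2 / d)) as [N HN].
  assert (HN0 : 0 < INR N).
  { eapply Rle_lt_trans; [|exact HN]; apply Rlt_le, Rdiv_lt_0_compat; lra. }
  assert (HNd : 2 < INR N * d).
  { apply Rmult_lt_compat_r with (r := d) in HN; auto; unfold Rdiv in HN.
    rewrite Rmult_assoc, Rinv_l in HN; lra. }
  set (step := (t2 - t1) / INR N).
  assert (Hstep : 0 < step) by (apply Rdiv_lt_0_compat; lra).
  assert (HNs : INR N * step = t2 - t1) by (unfold step; field; lra).
  set (T := fun k => t1 + INR k * step).
  assert (HT : forall k, (k <= N)%nat -> t1 <= T k <= t2).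
  { intros k Hk; apply le_INR in Hk; pose proof (pos_INR k); unfold T; split; nra. }
  (* Otherwise each of the [N] equal steps moves the two exit points by at least [d] in total, and
     [N * d] exceeds 2. *)
  apply NNPP; intro Hno.
  assert (Hsum : forall k, (k <= N)%nat ->
    INR k * d <= fst (E (T 0%nat)) - fst (E (T k)) + (snd (E (T k)) - snd (E (T 0%nat)))).
  { induction k as [|k IH]; intro Hk; [simpl INR; lra|].
    specialize (IH ltac:(lia)).
    assert (Hk1 := HT k ltac:(lia)); assert (Hk2 := HT (S k) Hk).
    assert (Hlt : T k < T (S k)) by (unfold T; rewrite S_INR; nra).
    destruct (exits_monotone _ _ _ _ _ _ _ _ (HE _ Hk1) (HE _ Hk2)) as [M1 M2]; [nra|].
    rewrite S_INR; apply Rnot_lt_le; intro Hsmall; apply Hno.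
    exists (T k), (T (S k)), (fst (E (T k))), (snd (E (T k))),
      (fst (E (T (S k)))), (snd (E (T (S k)))).
    repeat split; try (apply HE; auto); try lra. }
  specialize (Hsum N (le_n N)).
  destruct (HE _ (HT 0%nat (Nat.le_0_l N))) as (? & ? & _).
  destruct (HE _ (HT N (le_n N))) as (? & ? & _); lra.
Qed.

(** * Squared distances and longest intervals *)

Definition sqdist (z w : R * R) : R := Rsqr (fst z - fst w) + Rsqr (snd z - snd w).

Lemma sqdist_nonneg z w : 0 <= sqdist z w.
Proof.
  unfold sqdist; pose proof (Rle_0_sqr (fst z - fst w)).
  pose proof (Rle_0_sqr (snd z - snd w)); lra.
Qed.

Lemma open_ball_sqdist z r w : 0 < r -> open_ball z r w <-> sqdist z w < r * r.
Proof.
  intro Hr; unfold open_ball, dist2, dist_euc; fold (sqdist z w).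
  pose proof (sqrt_sqrt _ (sqdist_nonneg z w)); pose proof (sqrt_pos (sqdist z w)).
  split; nra.
Qed.

Lemma closed_ball_sqdist z r w : 0 < r -> closed_ball z r w <-> sqdist z w <= r * r.
Proof.
  intro Hr; unfold closed_ball, dist2, dist_euc; fold (sqdist z w).
  pose proof (sqrt_sqrt _ (sqdist_nonneg z w)); pose proof (sqrt_pos (sqdist z w)).
  split; nra.
Qed.

(** Every admissible interval contains [a] and avoids both exit points, hence lies inside the
    interval they bound. That interval is itself admissible, so it is the one that [epsilon]
    picks. *)
Lemma longest_inner_exits f a r x y :
  0 < r -> exits (fun t => sqdist (f a) (f t)) a (r * r) x y ->
  p f a r = x /\ q f a r = y.
Proof.
  intros Hr (Hx & Hy & HTx & HTy & Hin).
  assert (Hsub : forall I, inner_interval f a r I -> x <= fst I /\ snd I <= y).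
  { intros [u v] (Hu & Hv & Ha & Hball); simpl in *.
    split; apply Rnot_lt_le; intro Hlt.
    - assert (Hbx := Hball x ltac:(lra)); apply open_ball_sqdist in Hbx; lra.
    - assert (Hby := Hball y ltac:(lra)); apply open_ball_sqdist in Hby; lra. }
  assert (Hxy : inner_interval f a r (x, y)).
  { repeat split; simpl; try lra; intros z Hz; apply open_ball_sqdist; auto. }
  assert (Hl : is_longest (inner_interval f a r) (longest (inner_interval f a r))).
  { unfold longest; apply epsilon_spec; exists (x, y); split; auto.
    intros J HJ; apply Hsub in HJ; simpl; lra. }
  destruct Hl as [Hl1 Hl2]; specialize (Hl2 _ Hxy); simpl in Hl2.
  apply Hsub in Hl1; unfold p, q; lra.
Qed.

Lemma path_continuous f : computable_path f ->
  continuous01 (fun x => fst (f x)) /\ continuous01 (fun x => snd (f x)).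
Proof.
  intro Hf; destruct (path_cells f Hf) as (m & X & Y & _ & _ & _ & _ & H).
  split; [apply cell_approx_continuous with m X|apply cell_approx_continuous with m Y];
    intros n j x Hx; now apply H.
Qed.

(** The preimage of the compact set range(g) under [f] is closed. The proof bounds the l1 distance
    [D] from [f x] to range(g) below by compactness, then uses continuity of [f]. *)
Lemma not_in_range_open f g x :
  computable_path f -> computable_path g -> 0 <= x <= 1 -> ~ in_range g (f x) ->
  exists d, 0 < d /\ forall y, 0 <= y <= 1 -> Rabs (y - x) < d -> ~ in_range g (f y).
Proof.
  intros Hf Hg Hx Hout.
  destruct (path_continuous f Hf) as [Hf1 Hf2], (path_continuous g Hg) as [Hg1 Hg2].
  set (D := fun u => Rabs (fst (g u) - fst (f x)) + Rabs (snd (g u) - snd (f x))).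
  assert (Hloc : forall u, exists d : posreal, 0 <= u <= 1 ->
    forall v, 0 <= v <= 1 -> Rabs (v - u) < d -> d <= D v).
  { intro u; destruct (classic (0 <= u <= 1)) as [Hu|Hu];
      [|exists (mkposreal 1 Rlt_0_1); tauto].
    assert (HD : 0 < D u).
    { apply Rnot_le_lt; intro HD; apply Hout; exists u; split; auto; unfold D in HD.
      pose proof (Rabs_pos (fst (g u) - fst (f x))) as P1.
      pose proof (Rabs_pos (snd (g u) - snd (f x))) as P2.
      apply injective_projections; apply Rminus_diag_uniq;
        [assert (E : Rabs (fst (g u) - fst (f x)) = 0) by lra
        |assert (E : Rabs (snd (g u) - snd (f x)) = 0) by lra];
        apply Rabs_eq_0 in E; exact E. }
    destruct (Hg1 u (D u / 4)) as (d1 & Hd1 & C1); [auto|lra|].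
    destruct (Hg2 u (D u / 4)) as (d2 & Hd2 & C2); [auto|lra|].
    (* One number serves both as radius of the neighbourhood and as lower bound for [D] on it, so a
       uniform bound on the radii also bounds [D]. *)
    assert (Hd : 0 < Rmin (D u / 2) (Rmin d1 d2)) by (repeat apply Rmin_pos; lra).
    exists (mkposreal _ Hd); intros _ v Hv Hvu; simpl in *.
    pose proof (Rmin_l (D u / 2) (Rmin d1 d2)); pose proof (Rmin_r (D u / 2) (Rmin d1 d2)).
    pose proof (Rmin_l d1 d2); pose proof (Rmin_r d1 d2).
    specialize (C1 v Hv ltac:(lra)); specialize (C2 v Hv ltac:(lra)).
    pose proof (Rabs_triang (fst (g v) - fst (f x)) (fst (g u) - fst (g v))) as T1.
    pose proof (Rabs_triang (snd (g v) - snd (f x)) (snd (g u) - snd (g v))) as T2.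
    replace (fst (g v) - fst (f x) + (fst (g u) - fst (g v)))
      with (fst (g u) - fst (f x)) in T1 by ring.
    replace (snd (g v) - snd (f x) + (snd (g u) - snd (g v)))
      with (snd (g u) - snd (f x)) in T2 by ring.
    rewrite Rabs_minus_sym in C1; rewrite Rabs_minus_sym in C2.
    unfold D in *; lra. }
  apply choice in Hloc; destruct Hloc as [delta Hdelta].
  destruct (compactness_value_1d 0 1 delta) as [d Hd].
  assert (HdD : forall v, 0 <= v <= 1 -> d <= D v).
  { intros v Hv; apply Rnot_lt_le; intro Hlt; apply (Hd v Hv).
    intros (u & Hu & Hvu & Hdu); specialize (Hdelta u Hu v Hv Hvu); lra. }
  pose proof (cond_pos d) as Hdpos.
  destruct (Hf1 x (d / 2)) as (d1 & Hd1 & C1); [auto|lra|].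
  destruct (Hf2 x (d / 2)) as (d2 & Hd2 & C2); [auto|lra|].
  exists (Rmin d1 d2); split; [now apply Rmin_pos|].
  intros y Hy Hyx (u & Hu & Egu); pose proof (Rmin_l d1 d2); pose proof (Rmin_r d1 d2).
  specialize (HdD u Hu); unfold D in HdD; rewrite Egu in HdD.
  specialize (C1 y Hy ltac:(lra)); specialize (C2 y Hy ltac:(lra)); lra.
Qed.

(** As a difference of squares, the error is a product of a factor at most [2 * e] and a factor at
    most [2 + 2 * e <= 4]. *)
Lemma Rsqr_diff_approx u v u' v' e :
  0 <= u <= 1 -> 0 <= v <= 1 -> e <= 1 -> Rabs (u' - u) <= e -> Rabs (v' - v) <= e ->
  Rabs ((u' - v') * (u' - v') - Rsqr (v - u)) <= 8 * e.
Proof.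
  intros Hu Hv He Hu' Hv'; apply Rabs_le_between in Hu'; apply Rabs_le_between in Hv'.
  replace ((u' - v') * (u' - v') - Rsqr (v - u))
    with (((u' - u) - (v' - v)) * ((u' - u) - (v' - v) + 2 * (u - v)))
    by (unfold Rsqr; ring).
  rewrite Rabs_mult; replace (8 * e) with ((2 * e) * 4) by ring.
  apply Rmult_le_compat; try apply Rabs_pos; apply Rabs_le; lra.
Qed.

Lemma sqdist_cells f (a : Q) :
  computable_path f -> (forall t, 0 <= t <= 1 -> closed_square (f t)) -> 0 <= Q2R a <= 1 ->
  exists m V, recf m /\ recR V /\ (forall n, (n <= m n)%nat) /\
    cell_approx m V (fun x => sqdist (f (Q2R a)) (f x)).
Proof.
  intros Hf Hsq Ha.
  destruct (path_cells f Hf) as (m & X & Y & Hm & HX & HY & Hmn & Happrox).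
  (* A cell containing the rational [a] is found by search; its value approximates the centre
     [f a]. *)
  destruct (recf_search (fun n i => (i <= 2 ^ m n)%nat /\
    dyadic (m n) i <= Q2R a /\ Q2R a <= dyadic (m n) (S i))) as (i & Hi & Hia).
  { repeat apply decP_and; [apply decP_le|apply decP_Rle|apply decP_Rle];
      auto using recR_const, recR_dyadic, recf_comp with recf. }
  { intro n; destruct (in_cell_floor (m n) (Q2R a) Ha) as (H1 & _ & H2); eauto. }
  (* Each squared coordinate costs 8 times the error; five extra bits gain a factor 32, enough for
     both. *)
  set (N := fun z => (5 + pr1 z)%nat).
  set (c := fun z => to_nat (N z, pr2 z)).
  set (ca := fun z => to_nat (N z, i (N z))).
  exists (fun n => m (5 + n)%nat),
    (fun z => (X (c z) - X (ca z)) * (X (c z) - X (ca z)) +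
              (Y (c z) - Y (ca z)) * (Y (c z) - Y (ca z))).
  assert (HN : recf N) by (apply (recf_add (fun _ => 5%nat)); auto with recf).
  assert (Hc : recf c) by (unfold c; auto with recf).
  assert (Hca : recf ca) by (unfold ca; auto using recf_comp with recf).
  repeat split.
  - apply (recf_comp m); auto; apply (recf_add (fun _ => 5%nat)); auto with recf.
  - apply recR_add; apply recR_mul; apply recR_sub; apply recR_comp; auto.
  - intro n; specialize (Hmn (5 + n)%nat); lia.
  - intros n j x Hx; unfold c, ca, N; rewrite cancel_of_to; cbn [fst snd].
    set (k := (5 + n)%nat) in *.
    assert (Hak : in_cell (m k) (i k) (Q2R a)) by (repeat split; apply Hia || lra).
    destruct (Happrox _ _ _ Hx) as [X1 Y1], (Happrox _ _ _ Hak) as [X2 Y2].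
    destruct (Hsq x) as [S1 S2]; [apply Hx|]; destruct (Hsq (Q2R a) Ha) as [S3 S4].
    assert (Hk : 32 * (/ 2) ^ k = (/ 2) ^ n) by (unfold k; simpl; field).
    assert (Hk1 : (/ 2) ^ k <= 1) by (apply (half_pow_le 0); lia).
    pose proof (Rsqr_diff_approx _ _ _ _ _ S1 S3 Hk1 X1 X2) as E1.
    pose proof (Rsqr_diff_approx _ _ _ _ _ S2 S4 Hk1 Y1 Y2) as E2.
    apply Rabs_le_between in E1; apply Rabs_le_between in E2.
    pose proof (half_pow_pos k); unfold sqdist; apply Rabs_le; lra.
Qed.

(** * Computable enclosures of the exit points *)

(** Evidence, at precision [n] and on the grid of level [m n], that the exit points
    for all levels between [T1] and [T2] lie in [[i; j]] and [[j'; i']]. *)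
Definition pinned (m : nat -> nat) (V : nat -> R) (a : R) (n i j j' i' : nat)
    (T1 T2 : R) : Prop :=
  (i <= j)%nat /\ (S j <= j')%nat /\ (j' <= i')%nat /\ (i' <= 2 ^ m n)%nat /\
  dyadic (m n) j <= a /\ a <= dyadic (m n) j' /\
  (forall l, (l <= j')%nat -> (j <= l)%nat -> (S l <= j')%nat ->
     V (to_nat (n, l)) + (/ 2) ^ n < T1) /\
  T2 + (/ 2) ^ n < V (to_nat (n, i)) /\ T2 + (/ 2) ^ n < V (to_nat (n, i')).

Lemma decP_pinned m V (a : Q) N I J J' I' T1 T2 :
  recf m -> recR V -> recf N -> recf I -> recf J -> recf J' -> recf I' ->
  recR T1 -> recR T2 ->
  decP (fun z => pinned m V (Q2R a) (N z) (I z) (J z) (J' z) (I' z) (T1 z) (T2 z)).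
Proof.
  intros Hm HV HN HI HJ HJ' HI' HT1 HT2; unfold pinned.
  assert (HmN : recf (fun z => m (N z))) by (apply recf_comp; auto).
  assert (HVN : forall A, recf A -> recR (fun z => V (to_nat (N z, A z)))).
  { intros; apply (recR_comp V); auto with recf. }
  repeat apply decP_and; auto using decP_le, decP_Rle, decP_Rlt, recR_const, recR_dyadic,
    recR_add, recR_half_pow with recf.
  apply (decP_forall (fun z l => (J z <= l)%nat -> (S l <= J' z)%nat ->
     V (to_nat (N z, l)) + (/ 2) ^ N z < T1 z) J'); auto.
  pose proof (recf_comp _ _ HN (recf_pr1 _ recf_id)) as HN'.
  pose proof (recf_comp _ _ HJ (recf_pr1 _ recf_id)).
  pose proof (recf_comp _ _ HJ' (recf_pr1 _ recf_id)).
  repeat apply decP_imp; [auto using decP_le with recf..|].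
  apply decP_Rlt; [apply recR_add|].
  - apply (recR_comp V); auto with recf.
  - now apply recR_half_pow.
  - apply (recR_comp T1); auto with recf.
Qed.

(** From grid point [j] to [j'] the function stays below [T1], so no exit point lies there. At [i]
    and [i'] it exceeds [T2], so these grid points are not strictly between the exit points. The
    position of [a] tells the two sides apart. *)
Lemma pinned_exits m V H a n i j j' i' T1 T2 T x y :
  cell_approx m V H -> pinned m V a n i j j' i' T1 T2 -> T1 <= T <= T2 ->
  exits H a T x y ->
  dyadic (m n) i <= x <= dyadic (m n) j /\ dyadic (m n) j' <= y <= dyadic (m n) i'.
Proof.
  intros HV (Hij & Hjj & Hji & Hi & Hja & Haj & Hlow & Hhi & Hhi') HT
    (Hx & Hy & HTx & HTy & Hin).
  assert (Hgrid : forall l, (l <= 2 ^ m n)%nat -> in_cell (m n) l (dyadic (m n) l)).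
  { intros l Hl; pose proof (half_pow_pos (m n)); pose proof (dyadic_nonneg (m n) l).
    pose proof (dyadic_le (m n) _ _ Hl) as Hle; rewrite dyadic_full in Hle.
    repeat split; auto; rewrite ?dyadic_S; lra. }
  assert (Hmid : forall z, dyadic (m n) j <= z <= dyadic (m n) j' -> H z < T).
  { intros z Hz.
    assert (Hcell : exists l, (j <= l < j')%nat /\ in_cell (m n) l z).
    { pose proof (dyadic_nonneg (m n) j) as H0.
      pose proof (dyadic_le (m n) j' (2 ^ m n) ltac:(lia)) as H1; rewrite dyadic_full in H1.
      destruct (Rlt_le_dec z (dyadic (m n) j')) as [Hlt|Hge].
      - assert (Hc := in_cell_floor (m n) z ltac:(lra)).
        exists (nat_floor (z * 2 ^ m n)); split; [|exact Hc].
        destruct (dyadic_floor (m n) z) as [F1 F2]; [lra|].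
        split; [|apply (dyadic_lt_inv (m n)); lra].
        assert (Hlt' : dyadic (m n) j < dyadic (m n) (S (nat_floor (z * 2 ^ m n)))) by lra.
        apply dyadic_lt_inv in Hlt'; lia.
      (* The right end [j'] belongs to the closed cell [j' - 1], the last one that is tested. *)
      - exists (Nat.pred j'); split; [lia|].
        pose proof (dyadic_S (m n) (Nat.pred j')) as E.
        unfold in_cell; replace (S (Nat.pred j')) with j' in * by lia.
        pose proof (half_pow_pos (m n)); repeat split; try lia; lra. }
    destruct Hcell as (l & Hl & Hc); specialize (Hlow l ltac:(lia) ltac:(lia) ltac:(lia)).
    pose proof (HV _ _ _ Hc) as E; apply Rabs_le_between in E; lra. }
  assert (Hout : forall l, (l <= 2 ^ m n)%nat -> T2 + (/ 2) ^ n < V (to_nat (n, l)) ->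
                 T < H (dyadic (m n) l)).
  { intros l Hl Hlt; pose proof (HV _ _ _ (Hgrid l Hl)) as E.
    apply Rabs_le_between in E; lra. }
  apply Hout in Hhi; [|lia]; apply Hout in Hhi'; [|lia].
  pose proof (dyadic_le (m n) _ _ Hij); pose proof (dyadic_le (m n) _ _ Hji).
  repeat split; apply Rnot_lt_le; intro Hlt.
  - specialize (Hin (dyadic (m n) i) ltac:(lra)); lra.
  - specialize (Hmid x ltac:(lra)); lra.
  - specialize (Hmid y ltac:(lra)); lra.
  - specialize (Hin (dyadic (m n) i') ltac:(lra)); lra.
Qed.

(** The exit points for the outer levels [u] and [v], rounded to a fine grid, supply the evidence.
    The strict gaps [u < T1] and [T2 < v] absorb the approximation errors. *)
Lemma pinned_exist m V H a u v T1 T2 x y x' y' e :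
  cell_approx m V H -> (forall n, (n <= m n)%nat) ->
  exits H a u x y -> exits H a v x' y' -> u < T1 -> T1 < T2 -> T2 < v ->
  x - x' < e -> y' - y < e ->
  exists n i j j' i', pinned m V a n i j j' i' T1 T2 /\
    dyadic (m n) j - dyadic (m n) i <= e /\ dyadic (m n) i' - dyadic (m n) j' <= e.
Proof.
  intros HV Hm Hu Hv HuT HT HTv Hex Hey.
  destruct (exits_monotone _ _ _ _ _ _ _ _ Hu Hv) as [Hxx Hyy]; [lra|].
  destruct Hu as (Hx & Hy & _ & _ & Hin), Hv as (Hx' & Hy' & HTx & HTy & _).
  (* In a gap between levels the factor 2 covers the error of [V] and the margin in [pinned]; in a
     width it covers the rounding of two endpoints. *)
  assert (Hsmall : exists n, 2 * (/ 2) ^ n < T1 - u /\ 2 * (/ 2) ^ n < v - T2 /\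
    (/ 2) ^ n < a - x /\ (/ 2) ^ n < y - a /\
    2 * (/ 2) ^ n < e - (x - x') /\ 2 * (/ 2) ^ n < e - (y' - y)).
  { set (b := Rmin (Rmin (T1 - u) (v - T2))
      (Rmin (Rmin (a - x) (y - a)) (Rmin (e - (x - x')) (e - (y' - y))))).
    assert (Hb : 0 < b) by (unfold b; repeat apply Rmin_pos; lra).
    assert (Hb' : b <= T1 - u /\ b <= v - T2 /\ b <= a - x /\ b <= y - a /\
      b <= e - (x - x') /\ b <= e - (y' - y)).
    { unfold b, Rmin; repeat destruct Rle_dec; lra. }
    destruct (half_pow_small (b / 2)) as [n Hn]; [lra|].
    exists n; specialize (Hn n (le_n n)); lra. }
  destruct Hsmall as (n & S1 & S2 & S3 & S4 & S5 & S6); exists n.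
  pose proof (half_pow_le _ _ (Hm n)) as Hle; set (M := m n) in *.
  pose proof (half_pow_pos M) as Hpos.
  (* Only [j] is rounded up, to pass beyond [x]. For [i] and [i'] it suffices that their cells
     contain [x'] and [y'], since a value of [V] serves a whole cell. *)
  set (i := nat_floor (x' * 2 ^ M)); set (j := S (nat_floor (x * 2 ^ M))).
  set (j' := nat_floor (y * 2 ^ M)); set (i' := nat_floor (y' * 2 ^ M)).
  assert (Ci : in_cell M i x') by (apply in_cell_floor; lra).
  assert (Ci' : in_cell M i' y') by (apply in_cell_floor; lra).
  pose proof (dyadic_floor M x' ltac:(lra)) as Fi; fold i in Fi.
  pose proof (dyadic_floor M x ltac:(lra)) as Fj; fold j in Fj.
  pose proof (dyadic_floor M y ltac:(lra)) as Fj'; fold j' in Fj'.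
  pose proof (dyadic_floor M y' ltac:(lra)) as Fi'; fold i' in Fi'.
  pose proof (dyadic_S M (nat_floor (x * 2 ^ M))) as Ej; fold j in Ej.
  rewrite dyadic_S in Fj', Fi, Fi'.
  assert (Hj'i' : dyadic M j' < dyadic M (S i')) by (rewrite dyadic_S; lra).
  apply dyadic_lt_inv in Hj'i'.
  assert (Hij : dyadic M i < dyadic M j) by lra; apply dyadic_lt_inv in Hij.
  assert (Hjj : dyadic M j < dyadic M j') by lra; apply dyadic_lt_inv in Hjj.
  exists i, j, j', i'; unfold pinned; fold M.
  split; [|split; lra].
  pose proof (HV n _ _ Ci) as E1; apply Rabs_le_between in E1.
  pose proof (HV n _ _ Ci') as E2; apply Rabs_le_between in E2.
  repeat split; try lia; try lra; [apply Ci'|].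
  intros l _ Hjl Hlj.
  pose proof (dyadic_le M _ _ Hjl); pose proof (dyadic_le M _ _ Hlj) as Hl.
  rewrite dyadic_S in Hl.
  assert (Cl : in_cell M l (dyadic M l)).
  { repeat split; [destruct Ci' as [? _]; lia|apply dyadic_nonneg|lra|lra|].
    rewrite dyadic_S; lra. }
  pose proof (HV n _ _ Cl) as E; apply Rabs_le_between in E.
  specialize (Hin (dyadic M l) ltac:(lra)); lra.
Qed.

(** * Search for nested intervals of radii *)

Lemma val_dense u v : u < v -> exists n, u < val n < v.
Proof.
  intro Huv; destruct (INR_unbounded (/ (v - u))) as [N HN].
  assert (Hd : 0 < / (v - u)) by (apply Rinv_0_lt_compat; lra).
  assert (HNd : 1 < INR N * (v - u)).
  { apply Rmult_lt_compat_r with (r := v - u) in HN; [|lra].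
    rewrite Rinv_l in HN; lra. }
  destruct (archimed (u * INR N)) as [A1 A2]; set (z := up (u * INR N)) in *.
  destruct N as [|N]; [simpl in *; lra|].
  destruct (val_surjective (z # Pos.of_succ_nat N)) as [k Hk]; exists k; rewrite Hk.
  assert (E : Q2R (z # Pos.of_succ_nat N) * INR (S N) = IZR z).
  { unfold Q2R; cbn [Qnum Qden]; rewrite INR_IZR_INZ.
    replace (Z.of_nat (S N)) with (Z.pos (Pos.of_succ_nat N)) by lia.
    field; apply eq_IZR_contrapositive; lia. }
  assert (HS : 0 < INR (S N)) by (apply lt_0_INR; lia).
  split; apply Rmult_lt_reg_r with (INR (S N)); auto; rewrite E; lra.
Qed.

Lemma computable_number_of_approx A x :
  recR A -> (forall k, Rabs (A k - x) <= (/ 2) ^ k) -> computable_number x.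
Proof.
  intros (psi & [c Hc] & E) H; exists c, psi; split; auto.
  intro k; fold (val (psi k)); rewrite E; apply H.
Qed.

(** A search witness codes a precision, four grid indices and the two ends of an interval of
    radii. *)
Notation wit_n w := (pr1 w).
Notation wit_i w := (pr1 (pr2 w)).
Notation wit_j w := (pr1 (pr2 (pr2 w))).
Notation wit_j' w := (pr1 (pr2 (pr2 (pr2 w)))).
Notation wit_i' w := (pr1 (pr2 (pr2 (pr2 (pr2 w))))).
Notation wit_t1 w := (pr1 (pr2 (pr2 (pr2 (pr2 (pr2 w)))))).
Notation wit_t2 w := (pr2 (pr2 (pr2 (pr2 (pr2 (pr2 w)))))).

(** The radii [r < s] are refined to nested rational intervals whose intersection
    point has computable exit points. *)
Lemma computable_exits m V H (a r s : Q) :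
  recf m -> recR V -> (forall n, (n <= m n)%nat) -> cell_approx m V H ->
  0 < Q2R r < Q2R s ->
  (forall t, Q2R r <= t <= Q2R s -> exists x y, exits H (Q2R a) (t * t) x y) ->
  exists alpha beta, 0 <= alpha <= 1 /\ 0 <= beta <= 1 /\
    computable_number alpha /\ computable_number beta /\
    forall k, exists t : Q, Q2R r <= Q2R t <= Q2R s /\ exists x y,
      exits H (Q2R a) (Q2R t * Q2R t) x y /\
      Rabs (x - alpha) <= (/ 2) ^ k /\ Rabs (y - beta) <= (/ 2) ^ k.
Proof.
  intros Hm HV Hmn Happrox Hrs Hex.
  assert (Hmc : forall A, recf A -> recf (fun z => m (A z)))
    by (intro; now apply recf_comp).
  set (valid := fun w => Q2R r <= val (wit_t1 w) /\ val (wit_t1 w) < val (wit_t2 w) /\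
                         val (wit_t2 w) <= Q2R s).
  set (good := fun k w w' =>
    val (wit_t1 w) <= val (wit_t1 w') /\ val (wit_t2 w') <= val (wit_t2 w) /\
    pinned m V (Q2R a) (wit_n w') (wit_i w') (wit_j w') (wit_j' w') (wit_i' w')
      (val (wit_t1 w') * val (wit_t1 w')) (val (wit_t2 w') * val (wit_t2 w')) /\
    dyadic (m (wit_n w')) (wit_j w') - dyadic (m (wit_n w')) (wit_i w') <= (/ 2) ^ k /\
    dyadic (m (wit_n w')) (wit_i' w') - dyadic (m (wit_n w')) (wit_j' w') <= (/ 2) ^ k).
  assert (Hvalid : decP valid).
  { unfold valid; repeat apply decP_and; [apply decP_Rle|apply decP_Rlt|apply decP_Rle];
      auto 12 using recR_const, recR_val with recf. }
  destruct (recf_search (fun z w' => valid (pr2 z) -> valid w' /\ good (pr1 z) (pr2 z) w'))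
    as (next & Hnext & Hgood).
  { apply decP_imp; [apply (decP_comp valid); auto with recf|].
    apply decP_and; [apply (decP_comp valid); auto with recf|].
    unfold good.
    apply decP_and; [|apply decP_and; [|apply decP_and; [|apply decP_and]]].
    - apply decP_Rle; auto 12 using recR_val with recf.
    - apply decP_Rle; auto 12 using recR_val with recf.
    - apply decP_pinned; auto 12 with recf;
        apply recR_mul; auto 12 using recR_val with recf.
    - apply decP_Rle; [|auto using recR_half_pow with recf].
      apply recR_sub; apply recR_dyadic; auto 12 with recf.
    - apply decP_Rle; [|auto using recR_half_pow with recf].
      apply recR_sub; apply recR_dyadic; auto 12 with recf. }
  (* Invalid inputs receive the dummy witness 0, which keeps the search total. *)
  { intro z; destruct (classic (valid (pr2 z))) as [(Hr & Ht & Hs)|Hno];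
      [|exists 0%nat; tauto].
    set (t1 := val (wit_t1 (pr2 z))) in *; set (t2 := val (wit_t2 (pr2 z))) in *.
    destruct (exits_gap H (Q2R a) t1 t2 ((/ 2) ^ pr1 z)) as
      (u & v & x & y & x' & y' & Hu & Huv & Hv & Eu & Ev & Dx & Dy);
      [lra|apply half_pow_pos|intros t Htr; apply Hex; lra|].
    (* Rational radii strictly inside the gap leave the strict inequalities that [pinned_exist]
       requires. *)
    destruct (val_dense u v Huv) as (c1 & Hc1).
    destruct (val_dense (val c1) v ltac:(lra)) as (c2 & Hc2).
    destruct (pinned_exist m V H (Q2R a) (u * u) (v * v) (val c1 * val c1)
      (val c2 * val c2) x y x' y' ((/ 2) ^ pr1 z)) as
      (n & i & j & j' & i' & Hpin & W1 & W2); auto; try nra.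
    exists (to_nat (n, to_nat (i, to_nat (j, to_nat (j', to_nat (i', to_nat (c1, c2))))))).
    intros _; unfold valid, good; rewrite !cancel_of_to; cbn [fst snd].
    do 5 (rewrite !cancel_of_to; cbn [fst snd]); fold t1 t2.
    repeat split; try lra; apply Hpin. }
  destruct (val_surjective r) as [cr Hcr], (val_surjective s) as [cs Hcs].
  (* Only the two radii of the initial witness are meaningful; enclosures are read off from
     [W (S k)]. *)
  set (w0 := to_nat (0, to_nat (0, to_nat (0, to_nat (0, to_nat (0, to_nat (cr, cs))))))%nat).
  set (W := fun k => prim (fun _ => w0) (fun v => next (pr2 v)) 0%nat k).
  assert (HW : recf W).
  { apply recf_prim; auto with recf; apply (recf_comp next); auto with recf. }
  assert (HWS : forall k, W (S k) = next (to_nat (k, W k))).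
  { intro k; unfold W; cbn [prim]; now rewrite cancel_of_to. }
  assert (Hstep : forall k, valid (W k) -> valid (W (S k)) /\ good k (W k) (W (S k))).
  { intros k Hk; specialize (Hgood (to_nat (k, W k))); rewrite cancel_of_to in Hgood.
    rewrite HWS; apply Hgood, Hk. }
  assert (HWv : forall k, valid (W k)).
  { induction k as [|k IH]; [|now apply Hstep].
    unfold valid, W, w0; cbn [prim]; repeat (rewrite !cancel_of_to; cbn [fst snd]); lra. }
  assert (HWg : forall k, good k (W k) (W (S k))) by (intro; now apply Hstep).
  set (t1 := fun k => val (wit_t1 (W k))); set (t2 := fun k => val (wit_t2 (W k))).
  assert (Hrange : forall k, Q2R r <= t1 k /\ t1 k < t2 k /\ t2 k <= Q2R s)
    by (intro; apply HWv).
  assert (Hmono : forall k l, t1 k <= t1 (k + l)%nat /\ t2 (k + l)%nat <= t2 k).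
  { intros k l; induction l as [|l IH]; [rewrite Nat.add_0_r; lra|].
    rewrite Nat.add_succ_r; destruct (HWg (k + l)%nat) as (G1 & G2 & _).
    unfold t1, t2 in *; lra. }
  destruct (completeness (fun t => exists k, t = t1 k)) as (t & Hub & Hlub).
  { exists (Q2R s); intros t [k ->]; specialize (Hrange k); lra. }
  { now exists (t1 0%nat), 0%nat. }
  assert (Ht : forall k, t1 k <= t <= t2 k).
  { intro k; split; [apply Hub; eauto|apply Hlub; intros u [l ->]].
    pose proof (Hmono k l); pose proof (Hmono l k) as Hlk.
    rewrite (Nat.add_comm l k) in Hlk; pose proof (Hrange (k + l)%nat); lra. }
  (* The common radius [t] is real; its exit points lie in all the enclosures, whose widths tend to
     0. *)
  destruct (Hex t) as (alpha & beta & Eab).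
  { specialize (Ht 0%nat); specialize (Hrange 0%nat); lra. }
  assert (Hpin : forall k u x y, t1 (S k) <= u <= t2 (S k) -> exits H (Q2R a) (u * u) x y ->
    let w := W (S k) in
    dyadic (m (wit_n w)) (wit_i w) <= x <= dyadic (m (wit_n w)) (wit_j w) /\
    dyadic (m (wit_n w)) (wit_j' w) <= y <= dyadic (m (wit_n w)) (wit_i' w)).
  { intros k u x y Hu Exy w; destruct (HWg k) as (_ & _ & Hp & _).
    eapply pinned_exits; eauto; fold w; specialize (Hrange (S k)).
    fold (t1 (S k)) (t2 (S k)); unfold w; fold (t1 (S k)) (t2 (S k)); split; nra. }
  assert (HWS' : recf (fun k => W (S k))) by (apply (recf_comp W); auto with recf).
  exists alpha, beta; pose proof Eab as (Ha & Hb & _).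
  repeat split; try lra.
  - apply computable_number_of_approx with
      (fun k => dyadic (m (wit_n (W (S k)))) (wit_j (W (S k)))).
    + apply recR_dyadic; auto with recf.
    + intro k; destruct (HWg k) as (_ & _ & _ & D1 & D2).
      destruct (Hpin k t alpha beta (Ht _) Eab); apply Rabs_le; lra.
  - apply computable_number_of_approx with
      (fun k => dyadic (m (wit_n (W (S k)))) (wit_j' (W (S k)))).
    + apply recR_dyadic; auto 7 with recf.
    + intro k; destruct (HWg k) as (_ & _ & _ & D1 & D2).
      destruct (Hpin k t alpha beta (Ht _) Eab); apply Rabs_le; lra.
  (* The left end of the interval of radii is rational, and its exit points share the enclosures of
     [alpha] and [beta], of width at most [(/ 2) ^ k]. *)
  - intro k; exists (nuQ (wit_t1 (W (S k)))); fold (val (wit_t1 (W (S k)))).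
    fold (t1 (S k)); pose proof (Hrange (S k)) as Hr; split; [lra|].
    destruct (Hex (t1 (S k))) as (x & y & Exy); [lra|]; exists x, y; split; auto.
    destruct (HWg k) as (_ & _ & _ & D1 & D2).
    destruct (Hpin k t alpha beta (Ht _) Eab).
    destruct (Hpin k (t1 (S k)) x y) as [P1 P2]; [lra|auto|].
    split; apply Rabs_le; lra.
Qed.

(** * The computable exit points and the range of [g] *)

Theorem theorem3p2 :
  forall f g : R -> R * R,
    (forall t, 0 <= t <= 1 -> closed_square (f t)) ->
    (forall t, 0 <= t <= 1 -> closed_square (g t)) ->
    computable_path f ->
    computable_path g ->
    f 0 = (0, 0) ->
    f 1 = (1, 1) ->
    g 0 = (0, 1) ->
    g 1 = (1, 0) ->
    (forall t, 0 < t < 1 -> open_square (f t) /\ open_square (g t)) ->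
    predicate_Q f g ->
    exists alpha : R,
      0 <= alpha <= 1 /\ computable_number alpha /\ in_range g (f alpha).
Proof.
  intros f g Hsq _ Hf Hg Hf0 Hf1 _ _ _ (a & r & s & Ha & Hrs & Hball & HQ).
  set (H := fun x => sqdist (f (Q2R a)) (f x)).
  destruct (sqdist_cells f a Hf Hsq Ha) as (m & V & Hm & HV & Hmn & Happrox).
  fold H in Happrox.
  (* The path starts and ends at corners, outside the closed ball of radius [s], so exit points
     exist for all radii in question. *)
  assert (Hcorner : forall x, ~ open_square (f x) -> Q2R s * Q2R s < H x).
  { intros x Hx; apply Rnot_le_lt; intro Hle; apply Hx, Hball.
    apply closed_ball_sqdist; [lra|exact Hle]. }
  assert (H0 : Q2R s * Q2R s < H 0).
  { apply Hcorner; rewrite Hf0; unfold open_square; simpl; lra. }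
  assert (H1 : Q2R s * Q2R s < H 1).
  { apply Hcorner; rewrite Hf1; unfold open_square; simpl; lra. }
  assert (Hex : forall t, Q2R r <= t <= Q2R s -> exists x y, exits H (Q2R a) (t * t) x y).
  { intros t Ht; apply exits_exist; auto; try nra.
    - now apply cell_approx_continuous with m V.
    - unfold H, sqdist; rewrite !Rminus_diag, Rsqr_0; nra. }
  destruct (computable_exits m V H a r s Hm HV Hmn Happrox Hrs Hex) as
    (alpha & beta & Halpha & Hbeta & Calpha & Cbeta & Happr).
  (* Which of the two numbers works is decided classically; each is computable on its own. *)
  destruct (classic (in_range g (f alpha))) as [|Nalpha]; [exists alpha; auto|].
  destruct (classic (in_range g (f beta))) as [|Nbeta]; [exists beta; auto|].
  exfalso.
  destruct (not_in_range_open f g alpha Hf Hg Halpha Nalpha) as (d & Hd & Od).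
  destruct (not_in_range_open f g beta Hf Hg Hbeta Nbeta) as (d' & Hd' & Od').
  destruct (half_pow_small (Rmin d d')) as [k Hk]; [now apply Rmin_pos|].
  specialize (Hk k (le_n k)); pose proof (Rmin_l d d'); pose proof (Rmin_r d d').
  destruct (Happr k) as (t & Ht & x & y & Exy & Dx & Dy).
  destruct (longest_inner_exits f (Q2R a) (Q2R t) x y) as [Ep Eq]; [lra|exact Exy|].
  destruct Exy as (Hx & Hy & _).
  destruct (HQ t Ht) as (k' & l & [Kin Kmax] & [Lin Lmin] & Hrange).
  unfold K, L in *; rewrite Ep in *; rewrite Eq in *.
  (* The maximum of [K] is [p] and the minimum of [L] is [q], which are the exit points near [alpha]
     and [beta]. *)
  assert (Ek : k' = x) by (specialize (Kmax x); lra).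
  assert (El : l = y) by (specialize (Lmin y); lra).
  subst k' l; destruct Hrange as [Hr|Hr]; revert Hr; [apply Od|apply Od']; lra.
Qed.
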